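(* Let $\check{Y}\in\mathcal{F}$ be a feasible point of the QCQP that satisfies LICQ (the gradients $\nabla q_k(\check Y)$, $k\in\mathcal{B}_{\check Y}$, are linearly independent), where $\mathcal{B}_{\check Y}=\mathcal{E}\cup\{k\in\mathcal{I}: q_k(\check Y)=0\}$ is the set of binding constraints at $\check Y$. Suppose that $$\eta>\|A_0\|_1+\|A_0\|_2+\frac{2(2\rho_1+\rho_2)\,\|\nabla q_0(\check Y)\|_F}{s(\check Y)}$$ and that, for every $k\in\mathcal{I}\setminus\mathcal{B}_{\check Y}$, $$\eta>\|A_0\|_2+\|\nabla q_0(\check Y)\|_F\left(\sqrt{\frac{\|A_k\|_2}{|q_k(\check Y)|}}+\frac{\|\nabla q_k(\check Y)\|_F}{|q_k(\check Y)|}\right).$$ Then the penalized parabolic relaxation with initial point $\check Y$ and penalty $\eta$ has a unique optimal solution $(Y^*,X^* )$, and it satisfies $X^*=Y^*(Y^* )^\top$ and $q_0(Y^* )\le q_0(\check Y)$.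
   Context: Norms: $\|\cdot\|_F$ is the Frobenius norm; for matrices $\|\cdot\|_1,\|\cdot\|_2$ are the induced (operator) 1- and 2-norms. QCQP: let $\mathcal{E},\mathcal{I}$ be finite disjoint index sets (equalities and inequalities), not containing $0$. For $k\in\{0\}\cup\mathcal{E}\cup\mathcal{I}$ let $A_k$ be a real symmetric $n\times n$ matrix, $B_k\in\mathbb{R}^{n\times m}$, $c_k\in\mathbb{R}$, and $q_k(Y)=\mathrm{tr}\{Y^\top A_kY\}+2\,\mathrm{tr}\{B_k^\top Y\}+c_k$ for $Y\in\mathbb{R}^{n\times m}$ (so $\nabla q_k(Y)=2(A_kY+B_k)$). The QCQP is: minimize $q_0(Y)$ over $Y\in\mathbb{R}^{n\times m}$ subject to $q_k(Y)=0$ ($k\in\mathcal{E}$) and $q_k(Y)\le0$ ($k\in\mathcal{I}$). Its feasible set is $\mathcal{F}$. Penalized parabolic relaxation with initial point $\check Y\in\mathbb{R}^{n\times m}$ and penalty $\eta>0$: with $\bar q_k(Y,X)=\mathrm{tr}\{A_kX\}+2\,\mathrm{tr}\{B_k^\top Y\}+c_k$ and $e_i$ the standard basis of $\mathbb{R}^n$, minimize $\bar q_0(Y,X)+\eta\,\mathrm{tr}\{X-2\check YY^\top+\check Y\check Y^\top\}$ over $Y\in\mathbb{R}^{n\times m}$ and real symmetric $n\times n$ matrices $X$, subject to $\bar q_k(Y,X)=0$ ($k\in\mathcal{E}$), $\bar q_k(Y,X)\le0$ ($k\in\mathcal{I}$), and for all $i,j\in\{1,\dots,n\}$: $X_{ii}+X_{jj}-2X_{ij}\ge\|(e_i-e_j)^\top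 Y\|_2^2$ and $X_{ii}+X_{jj}+2X_{ij}\ge\|(e_i+e_j)^\top Y\|_2^2$. Singularity function at a feasible point: for $\mathcal{Q}\subseteq\mathcal{E}\cup\mathcal{I}$, the Jacobian $J_{\mathcal{Q}}(Y)\in\mathbb{R}^{|\mathcal{Q}|\times nm}$ has rows $\mathrm{vec}\{\nabla q_k(Y)\}^\top$, $k\in\mathcal{Q}$. For $Y\in\mathcal{F}$, $s(Y)$ is the smallest singular value $\sigma_{\min}(J_{\mathcal{B}_Y}(Y))$ if $|\mathcal{B}_Y|\le nm$, and $s(Y)=0$ otherwise; if $\mathcal{B}_Y=\emptyset$, $s(Y)=+\infty$ (so terms divided by $s(Y)$ are $0$). Pencil norms: for $\ell\in\{1,2\}$, $\rho_\ell=\max\{\|\sum_{k\in\mathcal{E}\cup\mathcal{I}}\tau_kA_k\|_\ell : \tau\in\mathbb{R}^{|\mathcal{E}\cup\mathcal{I}|},\ \|\tau\|_2=1\}$. *)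

(* Defs.v *)
From mathcomp Require Import all_boot all_order all_algebra.
From mathcomp Require Import all_classical all_reals all_analysis.

Set Implicit Arguments.
Unset Strict Implicit.
Unset Printing Implicit Defensive.

Import Order.TTheory GRing.Theory Num.Theory.

Local Open Scope classical_set_scope.
Local Open Scope ring_scope.

(* Vectors are passed to [norm1] and [norm2] as families over a finite type:
   [v^~ 0] for a column [v : 'cV_n], [v 0] for a row [v : 'rV_n]. *)
Definition norm1 (R : realType) (T : finType) (x : T -> R) : R :=
  \sum_t `|x t|.

Definition norm2 (R : realType) (T : finType) (x : T -> R) : R :=
  Num.sqrt (\sum_t x t ^+ 2).

Definition frobenius (R : realType) (n m : nat) (M : 'M[R]_(n, m)) : R :=
  Num.sqrt (\sum_i \sum_j M i j ^+ 2).

(* The suprema below are attained: each set is compact, and nonempty except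
   that [pencil_norm] ranges over an empty set when there is no constraint,
   in which case [sup set0 = 0]. *)
Definition opnorm (R : realType) (n : nat) (N : ('I_n -> R) -> R)
    (M : 'M[R]_n) : R :=
  sup [set N ((M *m x)^~ 0) | x in [set x : 'cV[R]_n | N (x^~ 0) <= 1]].

Definition opnorm1 (R : realType) (n : nat) (M : 'M[R]_n) : R :=
  opnorm (@norm1 R _) M.

Definition opnorm2 (R : realType) (n : nat) (M : 'M[R]_n) : R :=
  opnorm (@norm2 R _) M.

(* The singular values of [M] are the square roots of the eigenvalues of the
   smaller of its two Gram matrices, so that there are [minn p q] of them,
   counted with multiplicity. *)
Definition singular_value (R : realType) (p q : nat) (M : 'M[R]_(p, q))
    (s : R) : Prop :=
  0 <= s /\ (if (p <= q)%N then eigenvalue (M *m M^T) (s ^+ 2)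
             else eigenvalue (M^T *m M) (s ^+ 2)).

Definition sigma_min (R : realType) (p q : nat) (M : 'M[R]_(p, q)) : R :=
  inf [set s | singular_value M s].

(* [None] is the objective; [Some (inl k)] and [Some (inr k)] are the equality
   and the inequality constraints. *)
Record qcqp (R : realType) (n m : nat) (E I : finType) := Qcqp {
  qA : option (E + I) -> 'M[R]_n;
  qB : option (E + I) -> 'M[R]_(n, m);
  qc : option (E + I) -> R;
  qA_sym : forall k, (qA k)^T = qA k
}.

Section Qcqp.
Variables (R : realType) (n m : nat) (E I : finType) (P : qcqp R n m E I).

Definition quad (k : option (E + I)) (Y : 'M[R]_(n, m)) : R :=
  \tr (Y^T *m qA P k *m Y) + 2 * \tr ((qB P k)^T *m Y) + qc P k.

Definition grad (k : option (E + I)) (Y : 'M[R]_(n, m)) : 'M[R]_(n, m) :=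
  2 *: (qA P k *m Y + qB P k).

Definition feasible (Y : 'M[R]_(n, m)) : Prop :=
  (forall k : E, quad (Some (inl k)) Y = 0) /\
  (forall k : I, quad (Some (inr k)) Y <= 0).

Definition binding (Y : 'M[R]_(n, m)) : {set E + I} :=
  [set k | match k with
           | inl _ => true
           | inr _ => quad (Some k) Y == 0
           end].

Definition licq (Y : 'M[R]_(n, m)) : Prop :=
  free [seq grad (Some k) Y | k in binding Y].

(* [mxvec] lists the entries row by row, whereas vec is often taken column by
   column; this only permutes the columns of the Jacobian. *)
Definition constraint_jacobian (Q : {set E + I}) (Y : 'M[R]_(n, m)) :
    'M[R]_(#|Q|, n * m) :=
  \matrix_(i < #|Q|) mxvec (grad (Some (enum_val i)) Y).

Definition singularity (Y : 'M[R]_(n, m)) : \bar R :=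
  if binding Y == finset.set0 then +oo%E
  else if (#|binding Y| <= n * m)%N then
    (sigma_min (constraint_jacobian (binding Y) Y))%:E
  else 0%E.

Definition pencil_norm (N : 'M[R]_n -> R) : R :=
  sup [set N (\sum_k tau k *: qA P (Some k))
      | tau in [set tau : E + I -> R | norm2 tau = 1]].

Definition relax_quad (k : option (E + I)) (Y : 'M[R]_(n, m)) (X : 'M[R]_n) :
    R :=
  \tr (qA P k *m X) + 2 * \tr ((qB P k)^T *m Y) + qc P k.

Definition basis_vec (i : 'I_n) : 'cV[R]_n := delta_mx i 0.

Definition parabolic (Y : 'M[R]_(n, m)) (X : 'M[R]_n) : Prop :=
  forall i j : 'I_n,
    norm2 (((basis_vec i - basis_vec j)^T *m Y) 0) ^+ 2
      <= X i i + X j j - 2 * X i j /\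
    norm2 (((basis_vec i + basis_vec j)^T *m Y) 0) ^+ 2
      <= X i i + X j j + 2 * X i j.

Definition relax_feasible (Z : 'M[R]_(n, m) * 'M[R]_n) : Prop :=
  [/\ Z.2^T = Z.2,
      forall k : E, relax_quad (Some (inl k)) Z.1 Z.2 = 0,
      forall k : I, relax_quad (Some (inr k)) Z.1 Z.2 <= 0
    & parabolic Z.1 Z.2].

Definition relax_objective (Yc : 'M[R]_(n, m)) (eta : R)
    (Z : 'M[R]_(n, m) * 'M[R]_n) : R :=
  relax_quad None Z.1 Z.2
  + eta * \tr (Z.2 - 2 *: (Yc *m Z.1^T) + Yc *m Yc^T).

Definition relax_optimal (Yc : 'M[R]_(n, m)) (eta : R)
    (Z : 'M[R]_(n, m) * 'M[R]_n) : Prop :=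
  relax_feasible Z /\
  forall Z', relax_feasible Z' ->
    relax_objective Yc eta Z <= relax_objective Yc eta Z'.

End Qcqp.

(* Main.v *)
Require Import Defs.
From mathcomp Require Import all_boot all_order all_algebra.
From mathcomp Require Import all_classical all_reals all_analysis.
From mathcomp Require Import ring lra.
Import Order.TTheory GRing.Theory Num.Theory.
Import numFieldTopology.Exports numFieldNormedType.Exports.
Local Open Scope ring_scope.

Set Implicit Arguments.
Unset Strict Implicit.
Unset Printing Implicit Defensive.

(** The relaxation is exact because a single dual certificate works. Suppose
    that [Ys] is feasible and that multipliers [tau] make it a KKT point of the
    problem with objective [q_0(Y) + eta |Y - Yc|^2]. Put
    [N = A_0 + sum_k tau_k A_k]. At a relaxed feasible point [(Y, X)] the
    Lagrangian exceeds the penalized cost of [Ys] by exactly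
    [tr((eta I + N) W) + tr((eta I + N) D D^T)], where [W = X - Y Y^T] and
    [D = Y - Ys] ([relax_lagrangianE]). The parabolic inequalities say that
    [2 |W_ij| <= W_ii + W_jj], which Gram matrices such as [D D^T] satisfy too,
    and they are dual to diagonal dominance. So if every column of [N] has
    absolute sum at most [c < eta], the excess is at least
    [(eta - c) (tr W + |D|^2)]; it is non-negative and vanishes only if [Y = Ys]
    and [X = Y Y^T] ([kkt_relax_unique]).

    It remains to find a KKT point with small multipliers. Write [a0] for the
    operator 2-norm of [A_0], [g] for the norm of the gradient of [q_0] at [Yc]
    and [delta = g / (eta - a0)]. A minimizer of the penalized objective plus
    [t sum_k violation_k^2] costs at most as much as the feasible point [Yc], so
    it lies within [delta] of [Yc] ([penalized_radius]). There the constraints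
    that are slack at [Yc] remain slack ([nonbinding_stays]). Stationarity gives
    the multipliers [2 t violation_k]. Passing from [Yc] to the minimizer
    perturbs the gradient combination with coefficients [tau] by at most
    [2 rho_2 delta |tau|], so a lower bound [kappa] for the Jacobian of the
    binding constraints at [Yc] bounds the multipliers ([multiplier_le]),
    uniformly in [t]. By compactness the limit [t -> oo] yields an exact KKT
    point ([exact_kkt]) whose multipliers obey the same bound, and the
    hypothesis on [eta] turns this bound into [alpha + rho_1 |tau| < eta], with
    [alpha] the operator 1-norm of [A_0] ([multiplier_margin]): the columns of
    [N] are as short as required.

    The singularity function provides [kappa]: the smallest singular value
    bounds the Jacobian below, and independence of the gradients makes it
    positive ([rayleigh_minimizer], [binding_lower_bound]). *)

(** * Compactness *)

Section Continuity.
Context {S : topologicalType} {R : realType}.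

Lemma continuous_bigsum (I : Type) (r : seq I) (F : I -> S -> R) :
  (forall i, continuous (F i)) -> continuous (fun x => \sum_(i <- r) F i x).
Proof.
move=> cF; elim: r => [|i r IH] x.
  by under eq_fun do rewrite big_nil; exact: cvg_cst.
by under eq_fun do rewrite big_cons; apply: cvgD; [exact: cF|exact: IH].
Qed.

Lemma continuous_cstr (c : R) : continuous (fun _ : S => c).
Proof. by move=> x; exact: cvg_cst. Qed.

Lemma continuous_addr (f g : S -> R) : continuous f -> continuous g ->
  continuous (fun x => f x + g x).
Proof. by move=> cf cg x; apply: cvgD; [exact: cf|exact: cg]. Qed.

Lemma continuous_oppr (f : S -> R) : continuous f -> continuous (fun x => - f x).
Proof. by move=> cf x; apply: cvgN; exact: cf. Qed.

Lemma continuous_mulr (f g : S -> R) : continuous f -> continuous g ->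
  continuous (fun x => f x * g x).
Proof. by move=> cf cg x; apply: cvgM; [exact: cf|exact: cg]. Qed.

Lemma continuous_maxr (f g : S -> R) : continuous f -> continuous g ->
  continuous (fun x => Num.max (f x) (g x)).
Proof. by move=> cf cg x; apply: continuous_max; [exact: cf|exact: cg]. Qed.

Definition mx_continuous a b (M : S -> 'M[R]_(a, b)) :=
  forall i j, continuous (fun x => M x i j).

Lemma mx_continuous_cst a b (M : 'M[R]_(a, b)) : mx_continuous (fun=> M).
Proof. by move=> i j x; exact: cvg_cst. Qed.

Lemma mx_continuousD a b (M N : S -> 'M[R]_(a, b)) :
  mx_continuous M -> mx_continuous N -> mx_continuous (fun x => M x + N x).
Proof.
move=> cM cN i j x; under eq_fun do rewrite mxE.
by apply: cvgD; [exact: cM|exact: cN].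
Qed.

Lemma mx_continuousZ a b (f : S -> R) (M : S -> 'M[R]_(a, b)) :
  continuous f -> mx_continuous M -> mx_continuous (fun x => f x *: M x).
Proof.
move=> cf cM i j x; under eq_fun do rewrite mxE.
by apply: cvgM; [exact: cf|exact: cM].
Qed.

Lemma mx_continuous_sum a b (I : Type) (r : seq I) (F : I -> S -> 'M[R]_(a, b)) :
  (forall i, mx_continuous (F i)) ->
  mx_continuous (fun x => \sum_(i <- r) F i x).
Proof.
move=> cF i j; under eq_fun do rewrite summxE.
by apply: continuous_bigsum => k; exact: cF.
Qed.

Lemma mx_continuous_tr a b (M : S -> 'M[R]_(a, b)) :
  mx_continuous M -> mx_continuous (fun x => (M x)^T).
Proof. by move=> cM i j; under eq_fun do rewrite mxE; exact: cM. Qed.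

Lemma mx_continuousM a b c (M : S -> 'M[R]_(a, b)) (N : S -> 'M[R]_(b, c)) :
  mx_continuous M -> mx_continuous N -> mx_continuous (fun x => M x *m N x).
Proof.
move=> cM cN i j; under eq_fun do rewrite mxE.
by apply: continuous_bigsum => k x; apply: cvgM; [exact: cM|exact: cN].
Qed.

Lemma continuous_mxtrace a (M : S -> 'M[R]_a) :
  mx_continuous M -> continuous (fun x => \tr (M x)).
Proof. by move=> cM; apply: continuous_bigsum => i; exact: cM. Qed.

End Continuity.

(** With pointwise convergence Tychonoff's theorem makes boxes compact; the
    default topology on functions is that of uniform convergence. *)
Notation rfamily R T := (prod_topology (fun _ : T => R : Type)).

Definition box (R : realType) (T : finType) (r : R) : set (T -> R) :=
  [set x | forall t, `|x t| <= r].

Lemma continuous_coord (R : realType) (T : finType) (t : T) :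
  continuous (fun x : rfamily R T => x t).
Proof. exact: (@proj_continuous T (fun _ => R : topologicalType) t). Qed.

Lemma box_compact (R : realType) (T : finType) (r : R) :
  compact (box r : set (rfamily R T)).
Proof.
have := @tychonoff T (fun _ => R : topologicalType) (fun _ => `[- r, r]%classic)
  (fun _ => @segment_compact R (- r) r).
congr compact; rewrite predeqE => x; split => h t; have := h t.
  by rewrite /= in_itv /= ler_norml.
by rewrite /= in_itv /= ler_norml.
Qed.

(** A cluster point of ever better approximate solutions is an exact one. This
    is what allows a limit to be taken without extracting subsequences. *)
Lemma box_solution (R : realType) (T : finType) (r : R) (J : Type)
    (c : J -> rfamily R T -> R) :
  (forall j, continuous (c j)) ->
  (forall e, 0 < e -> exists2 x, box r x & forall j, c j x <= e) ->
  exists2 x, box r x & forall j, c j x <= 0.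
Proof.
move=> cc sol.
have e_gt0 (k : nat) : (0 : R) < k.+1%:R^-1 by rewrite invr_gt0.
have [u bu cu] : exists2 u : nat -> rfamily R T,
    (forall k, box r (u k)) & forall k j, c j (u k) <= k.+1%:R^-1.
  have w k : {x : rfamily R T | box r x /\ forall j, c j x <= k.+1%:R^-1}.
    by apply: cid; have [x] := sol _ (e_gt0 k); exists x.
  by exists (fun k => sval (w k)) => k; case: (svalP (w k)).
have [x [bx clx]] : (box r `&` cluster (u @ \oo) !=set0)%classic.
  by apply: (@box_compact R T r); exists 0%N => // k _; exact: bu.
exists x => // j; rewrite leNgt; apply/negP => cx.
pose d := c j x / 2; have d0 : 0 < d by rewrite divr_gt0.
have near_u : (u @ \oo)%classic [set y | c j y <= d]%classic.
  have [N _ hN] := near_infty_natSinv_lt (PosNum d0).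
  by exists N => // k /hN /= /ltW; apply: le_trans; exact: cu.
have near_x : nbhs (x : rfamily R T) [set y | d < c j y]%classic.
  apply: (cc j x [set y | d < y]%classic); apply: open_nbhs_nbhs; split.
    exact: open_gt.
  by rewrite /= /d ltr_pdivrMr// mulr_natr mulr2n ltrDl.
by have [y [/= /le_lt_trans h /h]] := clx _ _ near_u near_x; rewrite ltxx.
Qed.

Lemma box_minimum (R : realType) (T : finType) (r : R) (f g : rfamily R T -> R) :
  continuous f -> continuous g -> (exists2 x, box r x & g x = 0) ->
  exists x, [/\ box r x, g x = 0
    & forall y, box r y -> g y = 0 -> f x <= f y].
Proof.
move=> cf cg [x0 bx0 gx0].
pose A := (box r `&` [set x | g x = 0])%classic : set (rfamily R T).
have cA : compact A.
  apply: compact_closedI; first exact: box_compact.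
  by apply: (@preimage_closed _ _ g [set 0]%classic) => //; exact: closed_eq.
have A0 : (A !=set0)%classic by exists x0.
have [x] := compact_EVT_min A0 cA (continuous_subspaceT cf).
rewrite inE => -[bx gx] min_x; exists x; split => // y byy gy.
by apply: min_x; rewrite inE; split.
Qed.

(** * Euclidean and operator norms *)

Section EuclideanNorm.
Context {R : realType} {T : finType}.
Implicit Types x y : T -> R.

Lemma norm2_ge0 x : 0 <= norm2 x.
Proof. exact: sqrtr_ge0. Qed.

Lemma sqr_norm2 x : norm2 x ^+ 2 = \sum_t x t ^+ 2.
Proof. by rewrite sqr_sqrtr// sumr_ge0// => t _; exact: sqr_ge0. Qed.

Lemma norm2_eq0 x : norm2 x = 0 -> forall t, x t = 0.
Proof.
move=> x0 t; apply/eqP; rewrite -sqrf_eq0; apply/eqP.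
have /eqP := sqr_norm2 x; rewrite x0 expr0n/= eq_sym psumr_eq0.
  by move=> /allP /(_ t (mem_index_enum t)) /eqP.
by move=> i _; exact: sqr_ge0.
Qed.

Lemma normr_le_norm2 x t : `|x t| <= norm2 x.
Proof.
rewrite -ler_sqr ?nnegrE ?norm2_ge0//.
rewrite real_normK ?num_real// sqr_norm2 (bigD1 t)//= lerDl sumr_ge0// => i _.
exact: sqr_ge0.
Qed.

Lemma norm2Z (a : R) x : norm2 (fun t => a * x t) = `|a| * norm2 x.
Proof.
rewrite /norm2 -sqrtr_sqr -sqrtrM ?sqr_ge0//; congr Num.sqrt.
by rewrite mulr_sumr; apply: eq_bigr => t _; rewrite exprMn.
Qed.

(** Cauchy-Schwarz: the sum of the squares of [b^2 x_t - p y_t], where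
    [b = norm2 y] and [p] is the left-hand side, equals
    [b^2 (norm2 x ^+ 2 * b^2 - p^2)]. *)
Lemma sum_mul_le_norm2 x y : \sum_t x t * y t <= norm2 x * norm2 y.
Proof.
have [y0|y_neq0] := eqVneq (norm2 y) 0.
  by rewrite y0 mulr0 big1// => t _; rewrite (norm2_eq0 y0) mulr0.
have y_gt0 : 0 < norm2 y by rewrite lt_def y_neq0 norm2_ge0.
set p := \sum_t _.
have : 0 <= \sum_t (norm2 y ^+ 2 * x t - p * y t) ^+ 2.
  by rewrite sumr_ge0// => t _; exact: sqr_ge0.
have -> : \sum_t (norm2 y ^+ 2 * x t - p * y t) ^+ 2
    = norm2 y ^+ 2 * (norm2 x ^+ 2 * norm2 y ^+ 2 - p ^+ 2).
  transitivity (\sum_t ((norm2 y ^+ 2) ^+ 2 * x t ^+ 2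
      - 2 * norm2 y ^+ 2 * p * (x t * y t) + p ^+ 2 * y t ^+ 2)).
    by apply: eq_bigr => t _; ring.
  rewrite big_split big_split/= -mulr_sumr sumrN -!mulr_sumr -!sqr_norm2 -/p.
  ring.
rewrite pmulr_rge0 ?exprn_gt0// subr_ge0 -exprMn => pp.
rewrite (le_trans (ler_norm _))// -ler_sqr ?nnegrE ?mulr_ge0 ?norm2_ge0//.
by rewrite real_normK ?num_real.
Qed.

Lemma norm2D x y : norm2 (fun t => x t + y t) <= norm2 x + norm2 y.
Proof.
rewrite -ler_sqr ?nnegrE ?addr_ge0 ?norm2_ge0//.
have -> : norm2 (fun t => x t + y t) ^+ 2
    = norm2 x ^+ 2 + 2 * (\sum_t x t * y t) + norm2 y ^+ 2.
  rewrite !sqr_norm2 mulr_sumr -!big_split/=; apply: eq_bigr => t _; ring.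
by have := sum_mul_le_norm2 x y; nra.
Qed.

End EuclideanNorm.

Section Frobenius.
Context {R : realType}.

Lemma frobeniusE n m (M : 'M[R]_(n, m)) :
  frobenius M = norm2 (fun p : 'I_n * 'I_m => M p.1 p.2).
Proof. by rewrite /frobenius /norm2 pair_bigA. Qed.

Lemma mxtrace_trmulE n m (M N : 'M[R]_(n, m)) :
  \tr (M^T *m N) = \sum_i \sum_j M i j * N i j.
Proof.
rewrite exchange_big/=; apply: eq_bigr => j _; rewrite mxE.
by apply: eq_bigr => i _; rewrite mxE.
Qed.

Lemma frobenius_ge0 n m (M : 'M[R]_(n, m)) : 0 <= frobenius M.
Proof. exact: sqrtr_ge0. Qed.

Lemma sqr_frobenius n m (M : 'M[R]_(n, m)) :
  frobenius M ^+ 2 = \tr (M^T *m M).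
Proof.
rewrite frobeniusE sqr_norm2 mxtrace_trmulE pair_bigA/=.
by apply: eq_bigr => p _; rewrite expr2.
Qed.

Lemma sqr_frobeniusD n m (A B : 'M[R]_(n, m)) t : frobenius (A + t *: B) ^+ 2
  = frobenius A ^+ 2 + 2 * t * \tr (A^T *m B) + t ^+ 2 * frobenius B ^+ 2.
Proof.
rewrite !sqr_frobenius [(A + _)^T]linearD/= [(t *: B)^T]linearZ/=.
rewrite mulmxDl !mulmxDr !mxtraceD -!scalemxAl -!scalemxAr !mxtraceZ.
rewrite -[\tr (B^T *m A)]mxtrace_tr trmx_mul trmxK; ring.
Qed.

Lemma mxtrace_le_frobenius n m (M N : 'M[R]_(n, m)) :
  \tr (M^T *m N) <= frobenius M * frobenius N.
Proof.
rewrite mxtrace_trmulE pair_bigA !frobeniusE.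
exact: (sum_mul_le_norm2 (fun p => M p.1 p.2) (fun p => N p.1 p.2)).
Qed.

Lemma frobeniusZ n m a (M : 'M[R]_(n, m)) :
  frobenius (a *: M) = `|a| * frobenius M.
Proof.
rewrite !frobeniusE -norm2Z; congr norm2; apply/funext => p.
by rewrite mxE.
Qed.

Lemma frobeniusN n m (M : 'M[R]_(n, m)) : frobenius (- M) = frobenius M.
Proof. by rewrite -scaleN1r frobeniusZ normrN1 mul1r. Qed.

Lemma frobeniusD n m (M N : 'M[R]_(n, m)) :
  frobenius (M + N) <= frobenius M + frobenius N.
Proof.
rewrite !frobeniusE; apply: le_trans (norm2D _ _).
by rewrite le_eqVlt; apply/orP; left; apply/eqP; congr norm2;
  apply/funext => p; rewrite mxE.
Qed.

Lemma frobenius_eq0 n m (M : 'M[R]_(n, m)) : frobenius M = 0 -> M = 0.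
Proof.
rewrite frobeniusE => /norm2_eq0 M0; apply/matrixP => i j.
by rewrite (M0 (i, j)) mxE.
Qed.

Lemma mxtrace_ge_frobenius n m (M N : 'M[R]_(n, m)) :
  - (frobenius M * frobenius N) <= \tr (M^T *m N).
Proof.
have := mxtrace_le_frobenius M (- N).
by rewrite mulmxN linearN/= frobeniusN lerNl.
Qed.

Lemma normr_le_frobenius n m (M : 'M[R]_(n, m)) i j : `|M i j| <= frobenius M.
Proof.
by rewrite frobeniusE;
  apply: (normr_le_norm2 (fun p : 'I_n * 'I_m => M p.1 p.2) (i, j)).
Qed.

Lemma sqr_frobenius_col n m (M : 'M[R]_(n, m)) :
  frobenius M ^+ 2 = \sum_j norm2 ((col j M)^~ 0) ^+ 2.
Proof.
rewrite sqr_frobenius mxtrace_trmulE exchange_big/=; apply: eq_bigr => j _.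
by rewrite sqr_norm2; apply: eq_bigr => i _; rewrite mxE expr2.
Qed.

Lemma frobenius_mxvec n m (M : 'M[R]_(n, m)) : frobenius M = norm2 (mxvec M 0).
Proof.
rewrite frobeniusE /norm2; congr Num.sqrt.
rewrite (reindex (uncurry (@mxvec_index n m)))/=.
  by apply: eq_bigr => -[i j] _; rewrite /= mxvecE.
exact: curry_mxvec_bij.
Qed.

End Frobenius.

Section OperatorNorm.
Context {R : realType} {n : nat}.
Implicit Types (M : 'M[R]_n) (x : 'cV[R]_n).

Lemma norm1_mulmx_le M x :
  norm1 ((M *m x)^~ 0) <= (\sum_i \sum_j `|M i j|) * norm1 (x^~ 0).
Proof.
rewrite /norm1 mulr_suml; apply: ler_sum => i _; rewrite mxE.
apply: le_trans (ler_norm_sum _ _ _) _; rewrite mulr_suml.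
apply: ler_sum => j _; rewrite normrM ler_wpM2l// (bigD1 j)//=.
by rewrite lerDl sumr_ge0.
Qed.

Lemma norm2_le_norm1 (T : finType) (x : T -> R) : norm2 x <= norm1 x.
Proof.
have x_ge0 : 0 <= norm1 x by rewrite sumr_ge0.
rewrite -ler_sqr ?nnegrE ?norm2_ge0// sqr_norm2 expr2 /norm1 mulr_suml.
apply: ler_sum => t _; rewrite -real_normK ?num_real// expr2 ler_wpM2l//.
by rewrite (bigD1 t)//= lerDl sumr_ge0.
Qed.

Lemma norm2_mulmx_le M x :
  norm2 ((M *m x)^~ 0) <= (\sum_i \sum_j `|M i j|) * norm2 (x^~ 0).
Proof.
apply: le_trans (norm2_le_norm1 _) _; rewrite /norm1 mulr_suml.
apply: ler_sum => i _; rewrite mxE.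
apply: le_trans (ler_norm_sum _ _ _) _; rewrite mulr_suml.
by apply: ler_sum => j _; rewrite normrM ler_wpM2l// (normr_le_norm2 (x^~ 0)).
Qed.

Section Bounded.
Variable N : ('I_n -> R) -> R.
Hypothesis N0 : N (fun=> 0) = 0.
Hypothesis N_ge0 : forall y, 0 <= N y.
Hypothesis N_mulmx : forall M x,
  N ((M *m x)^~ 0) <= (\sum_i \sum_j `|M i j|) * N (x^~ 0).

Lemma opnorm_ubound M : ubound
  [set N ((M *m x)^~ 0) | x in [set x : 'cV[R]_n | N (x^~ 0) <= 1]]%classic
  (\sum_i \sum_j `|M i j|).
Proof.
move=> _ [x /= x1 <-]; apply: le_trans (N_mulmx _ _) _.
by rewrite ler_piMr// sumr_ge0// => i _; rewrite sumr_ge0.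
Qed.

Lemma opnorm_ge M (x : 'cV[R]_n) : N (x^~ 0) <= 1 -> N ((M *m x)^~ 0) <= opnorm N M.
Proof.
by move=> x1; apply: ub_le_sup; [exists (\sum_i \sum_j `|M i j|);
  exact: opnorm_ubound|exists x].
Qed.

Lemma opnorm_image_neq0 M :
  ([set N ((M *m x)^~ 0) | x in [set x : 'cV[R]_n | N (x^~ 0) <= 1]]
    !=set0)%classic.
Proof.
exists (N ((M *m (0 : 'cV[R]_n))^~ 0)); exists 0 => //=.
have -> : (0 : 'cV[R]_n)^~ 0 = fun=> 0 by apply/funext => i; rewrite mxE.
by rewrite N0.
Qed.

Lemma opnorm_le_sum M : opnorm N M <= \sum_i \sum_j `|M i j|.
Proof. exact: ge_sup (opnorm_image_neq0 M) (@opnorm_ubound M). Qed.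

Lemma opnorm_ge0 M : 0 <= opnorm N M.
Proof.
have [y [x x1 _]] := opnorm_image_neq0 M.
exact: le_trans (N_ge0 _) (opnorm_ge M x1).
Qed.

End Bounded.

Lemma norm1_cst0 (T : finType) : norm1 (fun _ : T => 0 : R) = 0.
Proof. by rewrite /norm1 big1// => t _; rewrite normr0. Qed.

Lemma norm2_cst0 (T : finType) : norm2 (fun _ : T => 0 : R) = 0.
Proof. by rewrite /norm2 big1 ?sqrtr0// => t _; rewrite expr0n. Qed.

Lemma norm1_ge0 (T : finType) (x : T -> R) : 0 <= norm1 x.
Proof. by rewrite sumr_ge0. Qed.

Lemma opnorm1_ge0 M : 0 <= opnorm1 M.
Proof.
by apply: opnorm_ge0 => *; rewrite ?norm1_cst0 ?norm1_ge0 ?norm1_mulmx_le.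
Qed.

Lemma opnorm2_ge0 M : 0 <= opnorm2 M.
Proof.
by apply: opnorm_ge0 => *; rewrite ?norm2_cst0 ?norm2_ge0 ?norm2_mulmx_le.
Qed.

Lemma opnorm1_le_sum M : opnorm1 M <= \sum_i \sum_j `|M i j|.
Proof. by apply: opnorm_le_sum => *; rewrite ?norm1_cst0 ?norm1_mulmx_le. Qed.

Lemma opnorm2_le_sum M : opnorm2 M <= \sum_i \sum_j `|M i j|.
Proof. by apply: opnorm_le_sum => *; rewrite ?norm2_cst0 ?norm2_mulmx_le. Qed.

Lemma col_sum_le_opnorm1 M j : \sum_i `|M i j| <= opnorm1 M.
Proof.
have e1 : norm1 ((delta_mx j 0 : 'cV[R]_n)^~ 0) <= 1.
  rewrite /norm1 (bigD1 j)//= big1 ?addr0 ?mxE ?eqxx ?normr1// => i ij.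
  by rewrite mxE (negbTE ij) normr0.
have := opnorm_ge norm1_mulmx_le M e1; congr (_ <= _).
by rewrite -colE /norm1; apply: eq_bigr => i _; rewrite mxE.
Qed.

Lemma norm2_mulmx_opnorm2 M x :
  norm2 ((M *m x)^~ 0) <= opnorm2 M * norm2 (x^~ 0).
Proof.
have [x0|x_neq0] := eqVneq (norm2 (x^~ 0)) 0.
  have -> : x = 0.
    by apply/matrixP => i j; rewrite ord1 (norm2_eq0 x0) mxE.
  rewrite mulmx0; have -> : (0 : 'cV[R]_n)^~ 0 = fun=> 0.
    by apply/funext => i; rewrite mxE.
  by rewrite norm2_cst0 mulr0.
set a := norm2 _ in x_neq0 *.
have a_gt0 : 0 < a by rewrite lt_def x_neq0 norm2_ge0.
have scale (y : 'cV[R]_n) : norm2 ((a^-1 *: y)^~ 0) = a^-1 * norm2 (y^~ 0).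
  rewrite -[X in X * _]ger0_norm ?invr_ge0 ?(ltW a_gt0)// -norm2Z.
  by congr norm2; apply/funext => i; rewrite mxE.
have := opnorm_ge norm2_mulmx_le M (x := a^-1 *: x).
rewrite -scalemxAr !scale mulVf// lexx => /(_ isT).
by rewrite mulrC ler_pdivrMr.
Qed.

Lemma frobenius_mulmx_le m M (D : 'M[R]_(n, m)) :
  frobenius (M *m D) <= opnorm2 M * frobenius D.
Proof.
rewrite -ler_sqr ?nnegrE ?mulr_ge0 ?frobenius_ge0 ?opnorm2_ge0//.
rewrite exprMn !sqr_frobenius_col mulr_sumr; apply: ler_sum => j _.
rewrite -exprMn ler_sqr ?nnegrE ?mulr_ge0 ?norm2_ge0 ?opnorm2_ge0//.
by rewrite colE -mulmxA -colE norm2_mulmx_opnorm2.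
Qed.

Lemma quadratic_form_le m M (D : 'M[R]_(n, m)) :
  `|\tr (D^T *m M *m D)| <= opnorm2 M * frobenius D ^+ 2.
Proof.
have := frobenius_mulmx_le M D; have := frobenius_ge0 D.
have := mxtrace_le_frobenius D (M *m D).
have := mxtrace_ge_frobenius D (M *m D).
by rewrite mulmxA ler_norml => *; nra.
Qed.

End OperatorNorm.

(** * Norms of pencils *)

Section Pencil.
Context {R : realType} {n m : nat} {E I : finType} (P : qcqp R n m E I).
Implicit Type tau : E + I -> R.

Definition pencil tau : 'M[R]_n := \sum_k tau k *: qA P (Some k).

Lemma pencil_sum_le tau : norm2 tau = 1 ->
  \sum_i \sum_j `|pencil tau i j|
    <= \sum_i \sum_j \sum_k `|qA P (Some k) i j|.
Proof.
move=> tau1; apply: ler_sum => i _; apply: ler_sum => j _.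
rewrite summxE; apply: le_trans (ler_norm_sum _ _ _) _.
apply: ler_sum => k _; rewrite mxE normrM ler_piMl//.
by rewrite -tau1 normr_le_norm2.
Qed.

Section Norm.
Variable N : 'M[R]_n -> R.
Hypothesis N_ge0 : forall M, 0 <= N M.
Hypothesis N_le_sum : forall M, N M <= \sum_i \sum_j `|M i j|.

Lemma pencil_norm_ge tau : norm2 tau = 1 -> N (pencil tau) <= pencil_norm P N.
Proof.
move=> tau1; apply: ub_le_sup; last by exists tau.
exists (\sum_i \sum_j \sum_k `|qA P (Some k) i j|) => _ [sigma /= s1 <-].
exact: le_trans (N_le_sum _) (pencil_sum_le s1).
Qed.

Lemma pencil_norm_ge0 : 0 <= pencil_norm P N.
Proof.
have [[tau tau1]|no_tau] := pselect (exists tau, norm2 tau = 1).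
  exact: le_trans (N_ge0 _) (pencil_norm_ge tau1).
rewrite /pencil_norm; set A := (X in sup X).
suff -> : A = set0 by rewrite sup0.
by rewrite -subset0 => y [tau tau1 _]; apply: no_tau; exists tau.
Qed.

End Norm.

Lemma pencilZ a tau : pencil (fun k => a * tau k) = a *: pencil tau.
Proof. by rewrite scaler_sumr; apply: eq_bigr => k _; rewrite scalerA. Qed.

Lemma pencil_sym tau : (pencil tau)^T = pencil tau.
Proof.
rewrite linear_sum/=; apply: eq_bigr => k _.
by rewrite linearZ/= qA_sym.
Qed.

(** Homogeneity reduces estimates on pencils to unit coefficient vectors. *)
Lemma pencil_normalize tau : exists2 sigma,
  pencil tau = norm2 tau *: pencil sigma & norm2 tau = 0 \/ norm2 sigma = 1.
Proof.
have [t0|t_neq0] := eqVneq (norm2 tau) 0.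
  exists tau; last by left.
  rewrite t0 scale0r /pencil big1// => k _.
  by rewrite (norm2_eq0 t0) scale0r.
exists (fun k => (norm2 tau)^-1 * tau k).
  by rewrite pencilZ scalerA mulfV// scale1r.
by right; rewrite norm2Z ger0_norm ?invr_ge0 ?norm2_ge0// mulVf.
Qed.

Lemma col_sum_pencil_le tau j :
  \sum_i `|pencil tau i j| <= pencil_norm P (@opnorm1 R n) * norm2 tau.
Proof.
have [sigma -> st] := pencil_normalize tau.
have -> : \sum_i `|(norm2 tau *: pencil sigma) i j|
    = norm2 tau * \sum_i `|pencil sigma i j|.
  rewrite mulr_sumr; apply: eq_bigr => i _.
  by rewrite mxE normrM ger0_norm ?norm2_ge0.
rewrite [leRHS]mulrC; case: st => [->|sigma1]; first by rewrite !mul0r.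
rewrite ler_wpM2l ?norm2_ge0//; apply: le_trans (col_sum_le_opnorm1 _ _) _.
exact: pencil_norm_ge (@opnorm1_le_sum R n) _ sigma1.
Qed.

Lemma frobenius_pencil_le tau p (D : 'M[R]_(n, p)) :
  frobenius (pencil tau *m D)
    <= pencil_norm P (@opnorm2 R n) * norm2 tau * frobenius D.
Proof.
have [sigma -> st] := pencil_normalize tau.
rewrite -scalemxAl frobeniusZ ger0_norm ?norm2_ge0// [X in _ <= X * _]mulrC.
rewrite -mulrA; case: st => [->|sigma1]; first by rewrite !mul0r.
rewrite ler_wpM2l ?norm2_ge0//; apply: le_trans (frobenius_mulmx_le _ _) _.
rewrite ler_wpM2r ?frobenius_ge0//.
exact: pencil_norm_ge (@opnorm2_le_sum R n) _ sigma1.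
Qed.

End Pencil.

(** * The smallest singular value *)

Section SmallestSingularValue.
Context {R : realType}.

(** First-order optimality without derivatives: along a line through a minimum
    the increments of the functions at hand are bounded above by such a
    polynomial. *)
Lemma linear_coef_eq0 (a b : R) :
  (forall t, `|t| <= 1 -> 0 <= a * t + b * t ^+ 2) -> a = 0.
Proof.
move=> ab; apply/eqP/negPn/negP => a_neq0.
pose s := (1 + `|a| + `|b|)^-1.
have den_gt0 : 0 < 1 + `|a| + `|b| by rewrite !ltr_wpDr.
have s_gt0 : 0 < s by rewrite invr_gt0.
have s_den : s * (1 + `|a| + `|b|) = 1 by rewrite mulVf// gt_eqF.
have a_gt0 : 0 < a ^+ 2 by rewrite exprn_even_gt0.
(* A step against the sign of [a], short enough for the linear term to win. *)
have t_le1 : `|- (s * a)| <= 1.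
  rewrite normrN normrM (gtr0_norm s_gt0).
  by have := normr_ge0 a; have := normr_ge0 b; nra.
have := ab _ t_le1.
have -> : a * - (s * a) + b * (- (s * a)) ^+ 2 = a ^+ 2 * s * (b * s - 1).
  by ring.
rewrite (pmulr_rge0 _ (mulr_gt0 a_gt0 s_gt0)).
rewrite subr_ge0 leNgt => /negP; apply.
by have := ler_norm b; have := normr_ge0 a; nra.
Qed.

Lemma norm2_row p (v : 'rV[R]_p) : norm2 (v 0) = frobenius v.
Proof. by rewrite [RHS]/frobenius big_ord1. Qed.

Lemma mxtrace_mulmxr k p q (A B : 'M[R]_(k, p)) (M : 'M[R]_(p, q)) :
  \tr ((A *m M)^T *m (B *m M)) = \tr (A^T *m (B *m (M *m M^T))).
Proof. by rewrite trmx_mul -mulmxA mxtrace_mulC !mulmxA. Qed.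

(** A minimizer [v] of [|v M|] on the unit sphere is an eigenvector of
    [M M^T]: the non-negative form [|w M|^2 - |v M|^2 |w|^2] vanishes at [v],
    hence so does its gradient there. *)
Lemma rayleigh_minimizer p q (M : 'M[R]_(p, q)) : (0 < p)%N -> (p <= q)%N ->
  exists v : 'rV[R]_p,
    [/\ frobenius v = 1, singular_value M (frobenius (v *m M))
    & forall w : 'rV[R]_p, frobenius (v *m M) * frobenius w <= frobenius (w *m M)].
Proof.
case: p M => // p M _ pq.
pose row_of (x : 'I_p.+1 -> R) : 'rV[R]_p.+1 := \row_i x i.
have c_row : mx_continuous (row_of : rfamily R 'I_p.+1 -> 'rV[R]_p.+1).
  move=> i j.
  have -> : (fun x : rfamily R 'I_p.+1 => row_of x i j) = (fun x => x j).
    by apply/funext => x; rewrite mxE.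
  exact: continuous_coord.
have c_rowM : mx_continuous (fun x : rfamily R 'I_p.+1 => row_of x *m M).
  by apply: mx_continuousM => //; exact: mx_continuous_cst.
have c_gram a b (L : rfamily R 'I_p.+1 -> 'M[R]_(a, b)) : mx_continuous L ->
    continuous (fun x => \tr ((L x)^T *m L x)).
  by move=> cL; apply: continuous_mxtrace; apply: mx_continuousM => //;
    exact: mx_continuous_tr.
pose g (x : rfamily R 'I_p.+1) := \tr ((row_of x)^T *m row_of x) - 1.
have c_g : continuous g.
  apply: (@continuous_addr _ _ _ (fun=> - 1)); first exact: (c_gram _ _ _ c_row).
  exact: continuous_cstr.
have ex_g : exists2 x, box 1 x & g x = 0.
  exists (fun i => (i == 0)%:R).
    by move=> i; case: (i == 0); rewrite ?normr1 ?normr0 ?ler01.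
  rewrite /g -sqr_frobenius -norm2_row sqr_norm2 (bigD1 0)//= mxE eqxx.
  rewrite big1 ?addr0 ?expr1n ?subrr// => i i0.
  by rewrite mxE (negbTE i0) expr0n.
have [x [_ gx min_x]] := box_minimum (c_gram _ _ _ c_rowM) c_g ex_g.
rewrite /g in gx min_x.
set v := row_of x in gx min_x.
have v1 : frobenius v ^+ 2 = 1.
  by rewrite sqr_frobenius; apply/eqP; rewrite -subr_eq0; apply/eqP.
set mu := frobenius (v *m M).
have mu_ge0 : 0 <= mu by exact: frobenius_ge0.
have min_v (w : 'rV[R]_p.+1) : mu * frobenius w <= frobenius (w *m M).
  have [->|w_neq0] := eqVneq (frobenius w) 0; first by rewrite mulr0 frobenius_ge0.
  have w_gt0 : 0 < frobenius w by rewrite lt_def w_neq0 frobenius_ge0.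
  pose u := (frobenius w)^-1 *: w.
  have u1 : frobenius u = 1.
    by rewrite frobeniusZ ger0_norm ?invr_ge0 ?frobenius_ge0// mulVf.
  have row_u : row_of (u 0) = u by apply/rowP => i; rewrite mxE.
  have box_u : box 1 (u 0) by move=> i; rewrite -u1 normr_le_frobenius.
  have := min_x (u 0) box_u; rewrite row_u -!sqr_frobenius u1 expr1n subrr.
  move=> /(_ erefl).
  rewrite ler_sqr ?nnegrE ?frobenius_ge0// -scalemxAl frobeniusZ.
  rewrite ger0_norm ?invr_ge0 ?frobenius_ge0// mulrC ler_pdivlMr//.
exists v; split => //.
  by apply/eqP; rewrite -(@eqrXn2 _ 2) ?frobenius_ge0// v1 expr1n.
split => //; rewrite pq.
apply/eigenvalueP; exists v; last first.
  apply: contra_eq_neq v1 => ->.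
  by rewrite sqr_frobenius mulmx0 linear0 eq_sym oner_eq0.
pose r := v *m (M *m M^T) - mu ^+ 2 *: v.
suff /frobenius_eq0/eqP : frobenius r = 0 by rewrite subr_eq0 => /eqP.
pose b := \tr (r^T *m r).
suff : 2 * b = 0.
  by rewrite /b -sqr_frobenius => /eqP; rewrite mulf_eq0 sqrf_eq0 pnatr_eq0 => /eqP.
apply: (@linear_coef_eq0 _ (frobenius (r *m M) ^+ 2 - mu ^+ 2 * frobenius r ^+ 2)).
move=> t _.
have : 0 <= frobenius ((v + t *: r) *m M) ^+ 2
    - mu ^+ 2 * frobenius (v + t *: r) ^+ 2.
  by rewrite subr_ge0 -exprMn ler_sqr ?nnegrE ?mulr_ge0 ?frobenius_ge0.
rewrite mulmxDl -scalemxAl !sqr_frobeniusD -/mu v1; congr (0 <= _).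
rewrite -[\tr ((v *m M)^T *m _)]mxtrace_tr -[\tr (v^T *m r)]mxtrace_tr.
rewrite ![(_^T *m _)^T]trmx_mul !trmxK mxtrace_mulmxr.
have -> : b = \tr (r^T *m (v *m (M *m M^T))) - mu ^+ 2 * \tr (r^T *m v).
  rewrite -mxtraceZ scalemxAr -[RHS](linearB (@mxtrace R _))/= -mulmxBr.
  by [].
ring.
Qed.

Section Bounds.
Variables (p q : nat) (M : 'M[R]_(p, q)).
Hypotheses (p_gt0 : (0 < p)%N) (pq : (p <= q)%N).

Lemma sigma_min_le (w : 'rV[R]_p) :
  sigma_min M * frobenius w <= frobenius (w *m M).
Proof.
have [v [_ sv min_v]] := rayleigh_minimizer M p_gt0 pq.
apply: le_trans (min_v w); rewrite ler_wpM2r ?frobenius_ge0//.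
by apply: ge_inf => //; exists 0 => s [].
Qed.

Lemma sigma_min_gt0 : (forall w : 'rV[R]_p, w *m M = 0 -> w = 0) ->
  0 < sigma_min M.
Proof.
move=> M_inj; have [v [v1 sv min_v]] := rayleigh_minimizer M p_gt0 pq.
have vM_gt0 : 0 < frobenius (v *m M).
  rewrite lt_def frobenius_ge0 andbT; apply/eqP => /frobenius_eq0 /M_inj v0.
  by move: v1; rewrite v0 /frobenius big1 ?sqrtr0 => [/eqP|i _];
    rewrite 1?eq_sym ?oner_eq0// big1// => j _; rewrite mxE expr0n.
apply: lt_le_trans vM_gt0 _; apply: lb_le_inf; first by exists (frobenius (v *m M)).
move=> s [s_ge0]; rewrite pq => /eigenvalueP [w wMM w_neq0].
have w_gt0 : 0 < frobenius w.
  by rewrite lt_def frobenius_ge0 andbT; apply: contra w_neq0 => /eqP/frobenius_eq0 ->.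
have : frobenius (w *m M) ^+ 2 = (s * frobenius w) ^+ 2.
  rewrite exprMn !sqr_frobenius mxtrace_mulmxr wMM.
  by rewrite -scalemxAr mxtraceZ.
move/eqP; rewrite eqrXn2 ?mulr_ge0 ?frobenius_ge0// => /eqP wM.
by rewrite -(ler_pM2r w_gt0) -wM min_v.
Qed.
End Bounds.

End SmallestSingularValue.

(** * Optimality certificates for the parabolic relaxation *)

(** Among symmetric matrices this cone is dual to that of the diagonally
    dominant matrices with non-negative diagonal. *)
Definition entry_dominated {R : realType} {n : nat} (W : 'M[R]_n) :=
  forall i j, 2 * `|W i j| <= W i i + W j j.

Section EntryDominated.
Context {R : realType} {n : nat}.

(** Expand the squared norms of the sums and differences of the rows of [D]. *)
Lemma gram_entry_dominated m (D : 'M[R]_(n, m)) : entry_dominated (D *m D^T).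
Proof.
move=> i j; rewrite !mxE.
have lin (s : R) : s ^+ 2 = 1 -> 0 <= \sum_l D i l * D^T l i
    + 2 * s * (\sum_l D i l * D^T l j) + \sum_l D j l * D^T l j.
  move=> s1; have : 0 <= \sum_l (D i l + s * D j l) ^+ 2.
    by rewrite sumr_ge0// => l _; exact: sqr_ge0.
  congr (_ <= _); rewrite mulr_sumr -!big_split/=; apply: eq_bigr => l _.
  rewrite !mxE; move: s1 (D i l) (D j l) => s1 a b.
  transitivity (a ^+ 2 + 2 * s * (a * b) + s ^+ 2 * b ^+ 2); first by ring.
  by rewrite s1; ring.
have := lin 1 (expr1n _ 2); have := lin (-1) (sqrr_sign R 1).
by case: (ler0P (\sum_l D i l * D^T l j)) => _; nra.
Qed.

(** The hypothesis on column sums makes [c I + N] diagonally dominant, so that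
    its product with [W] has non-negative trace. *)
Lemma mxtrace_entry_dominated (N W : 'M[R]_n) c : N^T = N ->
  (forall j, \sum_i `|N i j| <= c) -> entry_dominated W ->
  - (c * \tr W) <= \tr (N *m W).
Proof.
move=> Nsym Nc Wdom.
have N_sym i j : N i j = N j i by rewrite -[in LHS]Nsym mxE.
have W_ge0 i : 0 <= W i i by have := Wdom i i; have := normr_ge0 (W i i); lra.
have -> : \tr (N *m W) = \sum_i \sum_j N i j * W j i.
  by apply: eq_bigr => i _; rewrite mxE.
have lb : - \sum_i \sum_j `|N i j| * (W i i + W j j)
    <= 2 * \sum_i \sum_j N i j * W j i.
  rewrite -sumrN mulr_sumr; apply: ler_sum => i _.
  rewrite -sumrN mulr_sumr; apply: ler_sum => j _.
  have := Wdom j i; have := ler_norm (- (N i j * W j i)).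
  by rewrite normrN normrM; have := normr_ge0 (N i j); nra.
have half : \sum_i \sum_j `|N i j| * W j j <= c * \tr W.
  rewrite exchange_big/= mulr_sumr; apply: ler_sum => j _.
  by rewrite -mulr_suml ler_wpM2r.
have half' : \sum_i \sum_j `|N i j| * W i i <= c * \tr W.
  rewrite mulr_sumr; apply: ler_sum => i _; rewrite -mulr_suml ler_wpM2r//.
  by apply: le_trans (Nc i); apply: ler_sum => j _; rewrite N_sym.
have split_sum : \sum_i \sum_j `|N i j| * (W i i + W j j)
   = \sum_i \sum_j `|N i j| * W i i + \sum_i \sum_j `|N i j| * W j j.
  rewrite -big_split/=; apply: eq_bigr => i _; rewrite -big_split/=.
  by apply: eq_bigr => j _; rewrite mulrDr.
by rewrite split_sum in lb; lra.
Qed.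

Lemma entry_dominated_trace_ge0 (W : 'M[R]_n) : entry_dominated W -> 0 <= \tr W.
Proof.
move=> Wdom; rewrite sumr_ge0// => i _.
by have := Wdom i i; have := normr_ge0 (W i i); lra.
Qed.

Lemma entry_dominated_eq0 (W : 'M[R]_n) : entry_dominated W -> \tr W = 0 -> W = 0.
Proof.
move=> Wdom /eqP; rewrite psumr_eq0 => [/allP W0|i _]; last first.
  by have := Wdom i i; have := normr_ge0 (W i i); lra.
have Wii i : W i i = 0 by have /eqP := W0 i (mem_index_enum i).
apply/matrixP => i j; rewrite mxE; apply/eqP; rewrite -normr_le0.
by have := Wdom i j; rewrite !Wii; lra.
Qed.

(** The constraints bound [X] through [X_ii + X_jj -/+ 2 X_ij] only, and
    [Y Y^T] attains these bounds, so they concern the gap [X - Y Y^T] alone. *)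
Lemma parabolicP m (Y : 'M[R]_(n, m)) (X : 'M[R]_n) :
  parabolic Y X <-> entry_dominated (X - Y *m Y^T).
Proof.
have nrm (s : R) i j : norm2 (((basis_vec R i + s *: basis_vec R j)^T *m Y) 0) ^+ 2
    = (Y *m Y^T) i i + 2 * s * (Y *m Y^T) i j + s ^+ 2 * (Y *m Y^T) j j.
  have rowE l : ((basis_vec R i + s *: basis_vec R j)^T *m Y) 0 l
      = Y i l + s * Y j l.
    rewrite [(_ + _)^T]linearD/= [(s *: _)^T]linearZ/= mulmxDl -scalemxAl.
    by rewrite !trmx_delta -!rowE !mxE.
  rewrite sqr_norm2 !mxE 2!mulr_sumr -!big_split/=; apply: eq_bigr => l _.
  by rewrite rowE !mxE; ring.
have nrmB i j : norm2 (((basis_vec R i - basis_vec R j)^T *m Y) 0) ^+ 2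
    = (Y *m Y^T) i i - 2 * (Y *m Y^T) i j + (Y *m Y^T) j j.
  have := nrm (-1) i j; rewrite scaleN1r => ->; ring.
have nrmD i j : norm2 (((basis_vec R i + basis_vec R j)^T *m Y) 0) ^+ 2
    = (Y *m Y^T) i i + 2 * (Y *m Y^T) i j + (Y *m Y^T) j j.
  have := nrm 1 i j; rewrite scale1r => ->; ring.
have entryB i j : (X - Y *m Y^T) i j = X i j - (Y *m Y^T) i j.
  by rewrite mxE [X in _ + X = _]mxE.
split=> YX i j.
  have := YX i j; rewrite nrmB nrmD !entryB => -[].
  by case: (ler0P (X i j - _)) => _; lra.
have := YX i j; rewrite nrmB nrmD !entryB.
by have := ler_norm (X i j - (Y *m Y^T) i j);
  have := ler_norm (- (X i j - (Y *m Y^T) i j)); rewrite normrN; split; lra.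
Qed.

End EntryDominated.

Section QcqpAlgebra.
Context {R : realType} {n m : nat} {E I : finType} (P : qcqp R n m E I).
Implicit Types (Y D : 'M[R]_(n, m)) (X : 'M[R]_n) (tau : E + I -> R).

Lemma mxtrace_tr_lin (G U S D : 'M[R]_(n, m)) a : \tr ((G + a *: U + S)^T *m D)
  = \tr (G^T *m D) + a * \tr (U^T *m D) + \tr (S^T *m D).
Proof.
by rewrite !raddfD/= !mulmxDl !mxtraceD [(a *: U)^T]linearZ -scalemxAl mxtraceZ.
Qed.

Lemma quadD k Y D : quad P k (Y + D)
  = quad P k Y + \tr ((grad P k Y)^T *m D) + \tr (D^T *m qA P k *m D).
Proof.
rewrite /quad /grad [(Y + D)^T]linearD/= !mulmxDl !mulmxDr !mxtraceD.
rewrite [(2 *: _)^T]linearZ/= -scalemxAl mxtraceZ [(_ + _)^T]linearD/= mulmxDl.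
rewrite mxtraceD trmx_mul qA_sym.
have -> : \tr (D^T *m qA P k *m Y) = \tr (Y^T *m qA P k *m D).
  by rewrite -mxtrace_tr !trmx_mul trmxK qA_sym mulmxA.
ring.
Qed.

Lemma gradD k Y D : grad P k (Y + D) = grad P k Y + 2 *: (qA P k *m D).
Proof. by rewrite /grad mulmxDr -scalerDr addrAC. Qed.

Lemma relax_quadE k Y X :
  relax_quad P k Y X = quad P k Y + \tr (qA P k *m (X - Y *m Y^T)).
Proof.
rewrite /relax_quad /quad mulmxBr linearB/= -mulmxA [\tr (Y^T *m _)]mxtrace_mulC.
rewrite !mulmxA; ring.
Qed.

Lemma relax_objectiveE Yc eta Y X :
  relax_objective P Yc eta (Y, X) = quad P None Y
  + \tr (qA P None *m (X - Y *m Y^T))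
  + eta * (frobenius (Y - Yc) ^+ 2 + \tr (X - Y *m Y^T)).
Proof.
rewrite /relax_objective /= relax_quadE; congr (_ + eta * _).
rewrite sqr_frobenius mxtrace_mulC [(Y - Yc)^T]linearB/= mulmxBl !mulmxBr.
rewrite !(linearD, linearN)/= mxtraceZ -[\tr (Y *m Yc^T)]mxtrace_tr trmx_mul trmxK.
ring.
Qed.

Lemma relax_feasible_gram Y : feasible P Y -> relax_feasible P (Y, Y *m Y^T).
Proof.
move=> [eqY leY]; split => /= [|k|k|]; rewrite ?relax_quadE ?subrr ?mulmx0 ?linear0 ?addr0//.
  by rewrite trmx_mul trmxK.
by apply/parabolicP => i j; rewrite subrr !mxE normr0 mulr0 addr0.
Qed.

(** Both lifting and moving away from a stationary point change the Lagrangian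
    through the single matrix [eta I + A_0 + sum_k tau_k A_k], paired with
    [X - Y Y^T] and with the Gram matrix of [Y - Ys]; the identity combines
    [relax_quadE] with the exact second-order expansion [quadD]. *)
Lemma relax_lagrangianE Yc eta Ys tau Y X :
  grad P None Ys + (2 * eta) *: (Ys - Yc)
    + \sum_k tau k *: grad P (Some k) Ys = 0 ->
  let D := Y - Ys in let W := X - Y *m Y^T in
  let N := qA P None + pencil P tau in
  relax_objective P Yc eta (Y, X) + \sum_k tau k * relax_quad P (Some k) Y X
  = quad P None Ys + eta * frobenius (Ys - Yc) ^+ 2
    + \sum_k tau k * quad P (Some k) Ys
    + (\tr (N *m W) + eta * \tr W)
    + (\tr (N *m (D *m D^T)) + eta * \tr (D *m D^T)).
Proof.
move=> stat D W N.
have YE : Y = Ys + D by rewrite addrC subrK.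
clearbody D.
have -> : \sum_k tau k * relax_quad P (Some k) Y X
  = \sum_k tau k * quad P (Some k) Ys
    + \tr ((\sum_k tau k *: grad P (Some k) Ys)^T *m D)
    + \tr (pencil P tau *m (D *m D^T)) + \tr (pencil P tau *m W).
  rewrite [(\sum_k _)^T]linear_sum !mulmx_suml !linear_sum -!big_split/=.
  apply: eq_bigr => k _; rewrite relax_quadE -/W {1}YE quadD.
  rewrite [(tau k *: _)^T]linearZ/= -!scalemxAl !mxtraceZ.
  rewrite -[D^T *m _ *m D]mulmxA [\tr (D^T *m _)]mxtrace_mulC -mulmxA; ring.
rewrite relax_objectiveE -/W.
have -> : quad P None Y = quad P None Ys + \tr ((grad P None Ys)^T *m D)
    + \tr (qA P None *m (D *m D^T)).
  by rewrite YE quadD -[D^T *m _ *m D]mulmxA [\tr (D^T *m _)]mxtrace_mulC -mulmxA.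
have -> : frobenius (Y - Yc) ^+ 2 = frobenius (Ys - Yc) ^+ 2
    + 2 * \tr ((Ys - Yc)^T *m D) + \tr (D *m D^T).
  rewrite YE addrAC -[X in _ + X]scale1r sqr_frobeniusD [\tr (D *m _)]mxtrace_mulC.
  by rewrite -sqr_frobenius; ring.
have := congr1 (fun S => \tr (S^T *m D)) stat.
rewrite /= mxtrace_tr_lin trmx0 mul0mx mxtrace0 /N !mulmxDl ![\tr (_ + _ *m _)]mxtraceD.
lra.
Qed.

(** Weak duality: a relaxed feasible point costs at least as much as the KKT
    point, with a surplus that strict diagonal dominance of
    [eta I + A_0 + sum_k tau_k A_k] lets vanish only at the KKT point itself. *)
Lemma kkt_relax_unique Yc eta Ys tau c : feasible P Ys ->
  (forall k : I, 0 <= tau (inr k)) ->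
  (forall k, tau k * quad P (Some k) Ys = 0) ->
  grad P None Ys + (2 * eta) *: (Ys - Yc)
    + \sum_k tau k *: grad P (Some k) Ys = 0 ->
  (forall j, \sum_i `|(qA P None + pencil P tau) i j| <= c) -> c < eta ->
  unique (relax_optimal P Yc eta) (Ys, Ys *m Ys^T).
Proof.
move=> feasY tau_ge0 slack stat col_c c_eta.
have feasYX := relax_feasible_gram feasY.
have objE : relax_objective P Yc eta (Ys, Ys *m Ys^T)
    = quad P None Ys + eta * frobenius (Ys - Yc) ^+ 2.
  by rewrite relax_objectiveE subrr mulmx0 !linear0 !addr0.
have slack_sum : \sum_k tau k * quad P (Some k) Ys = 0 by rewrite big1.
have surplus Y X : relax_feasible P (Y, X) ->
    entry_dominated (X - Y *m Y^T) /\
    relax_objective P Yc eta (Ys, Ys *m Ys^T)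
    + (eta - c) * (\tr (X - Y *m Y^T) + \tr ((Y - Ys) *m (Y - Ys)^T))
    <= relax_objective P Yc eta (Y, X).
  move=> [/= _ eqYX leYX /parabolicP Wdom]; split=> //.
  have dual_le0 : \sum_k tau k * relax_quad P (Some k) Y X <= 0.
    apply: sumr_le0 => -[k|k] _; first by rewrite eqYX mulr0.
    by rewrite mulr_ge0_le0.
  have := relax_lagrangianE Y X stat.
  rewrite /= slack_sum addr0 -objE.
  have N_sym : (qA P None + pencil P tau)^T = qA P None + pencil P tau.
    by rewrite linearD/= qA_sym pencil_sym.
  have := mxtrace_entry_dominated N_sym col_c Wdom.
  have := mxtrace_entry_dominated N_sym col_c (gram_entry_dominated (Y - Ys)).
  by move: dual_le0; lra.
have eta_c : 0 < eta - c by rewrite subr_gt0.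
have gap_ge0 Y X : relax_feasible P (Y, X) ->
    0 <= \tr (X - Y *m Y^T) /\ 0 <= \tr ((Y - Ys) *m (Y - Ys)^T).
  move=> /surplus [Wdom _]; split; first exact: entry_dominated_trace_ge0.
  by apply: entry_dominated_trace_ge0; exact: gram_entry_dominated.
split; first split=> // -[Y X] feasZ.
  by have [_] := surplus _ _ feasZ; have [] := gap_ge0 _ _ feasZ; nra.
move=> [Y X] [feasZ /(_ _ feasYX) opt].
have [Wdom le_obj] := surplus _ _ feasZ; have [trW trD] := gap_ge0 _ _ feasZ.
have D0 : \tr ((Y - Ys) *m (Y - Ys)^T) = 0 by apply/eqP; rewrite eq_le trD; nra.
have W0 : \tr (X - Y *m Y^T) = 0 by apply/eqP; rewrite eq_le trW; nra.
have YE : Y = Ys.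
  apply/eqP; rewrite -subr_eq0; apply/eqP/frobenius_eq0/eqP.
  by rewrite -sqrf_eq0 sqr_frobenius mxtrace_mulC D0.
have /eqP := entry_dominated_eq0 Wdom W0; rewrite subr_eq0 => /eqP ->.
by rewrite YE.
Qed.

End QcqpAlgebra.

(** * A KKT point by quadratic penalties *)

Section Violation.
Context {R : realType} {E I : finType}.
Implicit Types (k : E + I) (q : R).

Definition violation k q : R :=
  match k with inl _ => q | inr _ => Num.max q 0 end.

Lemma violation_mul k q : violation k q * q = violation k q ^+ 2.
Proof.
by case: k => [k|k]/=; rewrite expr2// maxEle; case: ifP; rewrite ?mul0r.
Qed.

(** The derivative of [violation k q ^+ 2] is [2 * violation k q], which has
    Lipschitz constant 2; this bound replaces differentiation of the penalty. *)
Lemma sqr_violation_le k q q' : violation k q' ^+ 2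
  <= violation k q ^+ 2 + 2 * violation k q * (q' - q) + (q' - q) ^+ 2.
Proof.
case: k => [k|k]/=; first by rewrite le_eqVlt; apply/orP; left; apply/eqP; ring.
have sq := sqr_ge0 (q' - q); have sq' := sqr_ge0 q'.
by case: (leP q 0) => ?; case: (leP q' 0) => ?; nra.
Qed.

End Violation.

Section Penalty.
Context {R : realType} {n m : nat} {E I : finType} (P : qcqp R n m E I).
Variables (Yc : 'M[R]_(n, m)) (eta : R).
Implicit Types (Y D : 'M[R]_(n, m)) (tau : E + I -> R).

Let a0 := opnorm2 (qA P None).
Let g := frobenius (grad P None Yc).
Let delta := g / (eta - a0).

Hypothesis Yc_feasible : feasible P Yc.
Hypothesis a0_eta : a0 < eta.

Definition penalized Y := quad P None Y + eta * frobenius (Y - Yc) ^+ 2.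

Definition penalty t Y :=
  penalized Y + t * \sum_k violation k (quad P (Some k) Y) ^+ 2.

Definition lagrange_grad Y tau := grad P None Y + (2 * eta) *: (Y - Yc)
  + \sum_k tau k *: grad P (Some k) Y.

Lemma eta_a0_gt0 : 0 < eta - a0.
Proof. by rewrite subr_gt0. Qed.

Lemma delta_ge0 : 0 <= delta.
Proof. by rewrite divr_ge0 ?frobenius_ge0// ltW// eta_a0_gt0. Qed.

Lemma delta_mul : (eta - a0) * delta = g.
Proof. by rewrite mulrC divfK// gt_eqF// eta_a0_gt0. Qed.

Lemma penalized_ge Y : quad P None Yc
  + frobenius (Y - Yc) * ((eta - a0) * frobenius (Y - Yc) - g) <= penalized Y.
Proof.
have -> : penalized Y
    = quad P None (Yc + (Y - Yc)) + eta * frobenius (Y - Yc) ^+ 2.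
  by rewrite [Yc + _]addrC subrK.
move: (Y - Yc) => D; rewrite quadD.
have := mxtrace_ge_frobenius (grad P None Yc) D.
have := quadratic_form_le (qA P None) D; rewrite -/g -/a0 ler_norml => /andP[+ _].
lra.
Qed.

(** With [d] the distance from [Y] to [Yc], the cost has risen by at least
    [d ((eta - a0) d - g)], which is positive as soon as [d > delta]. *)
Lemma penalized_radius Y :
  penalized Y <= quad P None Yc -> frobenius (Y - Yc) <= delta.
Proof.
move=> /(le_trans (penalized_ge Y)); have := frobenius_ge0 (Y - Yc).
have := delta_mul; have := eta_a0_gt0; have := delta_ge0.
move: (frobenius _) => d dl_ge0 x_gt0 xdl d_ge0 le0.
rewrite leNgt; apply/negP => far; have d_gt0 := le_lt_trans dl_ge0 far.
rewrite -subr_gt0 in far; have := mulr_gt0 (mulr_gt0 x_gt0 d_gt0) far.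
by move: le0; rewrite -xdl; lra.
Qed.

Lemma penalized_lower Y : quad P None Yc - g * delta <= penalized Y.
Proof.
apply: le_trans (penalized_ge Y); have := frobenius_ge0 (Y - Yc).
have := delta_mul; have := eta_a0_gt0; have := delta_ge0.
move: (frobenius _) => d dl_ge0 x_gt0 xdl d_ge0; rewrite -xdl.
have := addr_ge0 (sqr_ge0 (d - delta)) (mulr_ge0 d_ge0 dl_ge0).
by move=> /(mulr_ge0 (ltW x_gt0)); lra.
Qed.

Lemma penalty_ge t Y : 0 <= t -> penalized Y <= penalty t Y.
Proof.
by move=> t0; rewrite lerDl mulr_ge0// sumr_ge0// => k _; rewrite sqr_ge0.
Qed.

Lemma violation_feasible k : violation k (quad P (Some k) Yc) = 0.
Proof.
case: Yc_feasible => eqYc leYc; case: k => k /=; first exact: eqYc.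
by apply/max_idPr; exact: leYc.
Qed.

Lemma penalty_Yc t : penalty t Yc = quad P None Yc.
Proof.
rewrite /penalty /penalized subrr big1 => [|k _].
  by rewrite sqr_frobenius mulmx0 linear0 !mulr0 !addr0.
by rewrite violation_feasible expr0n.
Qed.

Lemma continuous_quad (S : topologicalType) k (F : S -> 'M[R]_(n, m)) :
  mx_continuous F -> continuous (fun x => quad P k (F x)).
Proof.
move=> cF; apply: (@continuous_addr _ _ (fun x => _ + _) (fun=> _)).
  apply: (@continuous_addr _ _ (fun x => \tr _) (fun x => _ * _)).
    apply: continuous_mxtrace; apply: mx_continuousM => //.
    apply: mx_continuousM; last exact: mx_continuous_cst.
    exact: mx_continuous_tr.
  apply: (@continuous_mulr _ _ (fun=> _) (fun x => \tr _)).
    exact: continuous_cstr.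
  by apply: continuous_mxtrace; apply: mx_continuousM => //; exact: mx_continuous_cst.
exact: continuous_cstr.
Qed.

Lemma continuous_violation (S : topologicalType) (k : E + I) (f : S -> R) :
  continuous f -> continuous (fun x => violation k (f x) ^+ 2).
Proof.
move=> cf; have cv : continuous (fun x => violation k (f x)).
  case: k => k //=; apply: (@continuous_maxr _ _ f (fun=> 0)) => //.
  exact: continuous_cstr.
exact: (continuous_mulr cv cv).
Qed.

Lemma continuous_penalized (S : topologicalType) (F : S -> 'M[R]_(n, m)) :
  mx_continuous F -> continuous (fun x => penalized (F x)).
Proof.
move=> cF; apply: (@continuous_addr _ _ (fun x => quad _ _ _) (fun x => _ * _)).
  exact: continuous_quad.
apply: (@continuous_mulr _ _ (fun=> _) (fun x => _ ^+ 2)).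
  exact: continuous_cstr.
have cD : mx_continuous (fun x => F x - Yc).
  by apply: mx_continuousD => //; exact: mx_continuous_cst.
have -> : (fun x => frobenius (F x - Yc) ^+ 2)
    = (fun x => \tr ((F x - Yc)^T *m (F x - Yc))).
  by apply/funext => x; rewrite sqr_frobenius.
by apply: continuous_mxtrace; apply: mx_continuousM => //; exact: mx_continuous_tr.
Qed.

Lemma continuous_penalty (S : topologicalType) t (F : S -> 'M[R]_(n, m)) :
  mx_continuous F -> continuous (fun x => penalty t (F x)).
Proof.
move=> cF; apply: (@continuous_addr _ _ (fun x => penalized _) (fun x => _ * _)).
  exact: continuous_penalized.
apply: (@continuous_mulr _ _ (fun=> _) (fun x => \sum_k _)).
  exact: continuous_cstr.
by apply: continuous_bigsum => k; apply: continuous_violation; exact: continuous_quad.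
Qed.

(** The minimum over a box of radius [delta] around [Yc] is global: a point at
    distance more than [delta] costs more than [Yc]. *)
Lemma penalty_minimizer t : 0 <= t ->
  exists Y, forall Y', penalty t Y <= penalty t Y'.
Proof.
move=> t0.
pose F (x : rfamily R ('I_n * 'I_m)%type) := Yc + \matrix_(i, j) x (i, j).
have cF : mx_continuous F.
  apply: mx_continuousD; first exact: mx_continuous_cst.
  move=> i j.
  have -> : (fun x : rfamily R ('I_n * 'I_m)%type =>
      (\matrix_(i, j) x (i, j) : 'M[R]_(n, m)) i j) = (fun x => x (i, j)).
    by apply/funext => x; rewrite mxE.
  exact: continuous_coord.
have in_box : exists2 x : 'I_n * 'I_m -> R, box delta x & 0 = 0 :> R.
  by exists (fun=> 0) => // p; rewrite normr0 delta_ge0.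
have [x [_ _ min_x]] := box_minimum (continuous_penalty (t := t) cF)
  (@continuous_cstr _ R 0) in_box.
exists (F x) => Y'.
have F_coords Y : F (fun p => (Y - Yc) p.1 p.2) = Y.
  by apply/matrixP => i j; rewrite !mxE addrCA subrr addr0.
have [Y'_far|Y'_near] := ltP delta (frobenius (Y' - Yc)); last first.
  rewrite -(F_coords Y'); apply: min_x => // p.
  exact: le_trans (normr_le_frobenius _ _ _) Y'_near.
have Yc_le : penalty t (F x) <= quad P None Yc.
  rewrite -(penalty_Yc t) -[X in _ <= penalty t X](F_coords Yc); apply: min_x => // p.
  by rewrite subrr mxE normr0 delta_ge0.
apply: le_trans Yc_le (le_trans _ (penalty_ge Y' t0)).
by rewrite leNgt; apply/negP => /ltW/penalized_radius; rewrite leNgt Y'_far.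
Qed.

(** The derivative of the penalty along the Lagrangian gradient [H] itself is the
    squared norm of [H]. *)
Lemma penalty_stationary t Y : 0 <= t ->
  (forall Y', penalty t Y <= penalty t Y') ->
  lagrange_grad Y (fun k => 2 * t * violation k (quad P (Some k) Y)) = 0.
Proof.
move=> t0 min_Y; set tau := (fun k => _); set H := lagrange_grad _ _.
pose u k := \tr ((grad P (Some k) Y)^T *m H).
pose v k := \tr (H^T *m qA P (Some k) *m H).
(* An upper bound, for [|s| <= 1], of the second-order part of the increment of
   [penalty t] from [Y] to [Y + s *: H]. *)
pose b := \tr (H^T *m qA P None *m H) + eta * frobenius H ^+ 2
  + t * \sum_k (2 * violation k (quad P (Some k) Y) * v k + (`|u k| + `|v k|) ^+ 2).
apply: frobenius_eq0; apply/eqP; rewrite -sqrf_eq0 sqr_frobenius; apply/eqP.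
apply: (@linear_coef_eq0 _ _ b) => s s1.
have quad_s k : quad P k (Y + s *: H) = quad P k Y
    + s * \tr ((grad P k Y)^T *m H) + s ^+ 2 * \tr (H^T *m qA P k *m H).
  rewrite quadD [(s *: H)^T]linearZ/= -!scalemxAl -!scalemxAr !mxtraceZ; ring.
have penalty_s : penalty t (Y + s *: H) - penalty t Y
    <= \tr (H^T *m H) * s + b * s ^+ 2.
  have -> : \tr (H^T *m H) = \tr ((grad P None Y)^T *m H)
      + 2 * eta * \tr ((Y - Yc)^T *m H)
      + t * \sum_k 2 * violation k (quad P (Some k) Y) * u k.
    rewrite {1}/H /lagrange_grad mxtrace_tr_lin; congr (_ + _).
    rewrite [(\sum_k _)^T]linear_sum mulmx_suml linear_sum mulr_sumr/=.
    apply: eq_bigr => k _.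
    rewrite [(tau k *: _)^T]linearZ/= -scalemxAl mxtraceZ /tau /u; ring.
  have viol_s : \sum_k violation k (quad P (Some k) (Y + s *: H)) ^+ 2
      <= \sum_k violation k (quad P (Some k) Y) ^+ 2
       + s * (\sum_k 2 * violation k (quad P (Some k) Y) * u k)
       + s ^+ 2 * \sum_k (2 * violation k (quad P (Some k) Y) * v k
           + (`|u k| + `|v k|) ^+ 2).
    rewrite !mulr_sumr -!big_split/=; apply: ler_sum => k _.
    apply: le_trans (sqr_violation_le _ (quad P (Some k) Y) _) _.
    rewrite quad_s -/(u k) -/(v k).
    have : (s * u k + s ^+ 2 * v k) ^+ 2 <= s ^+ 2 * (`|u k| + `|v k|) ^+ 2.
      have -> : s * u k + s ^+ 2 * v k = s * (u k + s * v k) by ring.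
      rewrite exprMn ler_wpM2l ?sqr_ge0// -[leLHS]real_normK ?num_real//.
      rewrite ler_sqr ?nnegrE ?addr_ge0//; apply: le_trans (ler_normD _ _) _.
      by rewrite lerD2l normrM ler_piMl.
    move: (violation _ _) => w; lra.
  have frob_s : frobenius (Y + s *: H - Yc) ^+ 2 = frobenius (Y - Yc) ^+ 2
      + 2 * s * \tr ((Y - Yc)^T *m H) + s ^+ 2 * frobenius H ^+ 2.
    by rewrite addrAC sqr_frobeniusD.
  rewrite /penalty /penalized quad_s frob_s /b.
  have := ler_wpM2l t0 viol_s; lra.
by apply: le_trans penalty_s; rewrite subr_ge0.
Qed.

(** In units of [|q|], where [q < 0] is the value at [Yc], moving by [d] raises
    the constraint by at most [(d r)^2 + d w], with [r] the square root and [w]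
    the quotient in the hypothesis. As [delta (r + w) < 1], the square is at most
    [d r] and the rise stays below 1. *)
Lemma nonbinding_stays (k : I) Y : quad P (Some (inr k)) Yc < 0 ->
  a0 + g * (Num.sqrt (opnorm2 (qA P (Some (inr k)))
                      / `|quad P (Some (inr k)) Yc|)
            + frobenius (grad P (Some (inr k)) Yc)
              / `|quad P (Some (inr k)) Yc|) < eta ->
  frobenius (Y - Yc) <= delta -> quad P (Some (inr k)) Y < 0.
Proof.
set A := qA P _; set q := quad P _ Yc; set h := frobenius (grad P _ Yc).
move=> q_lt0; rewrite ltr0_norm// -ltrBrDl => far near.
have q_gt0 : 0 < - q by rewrite oppr_gt0.
pose r := Num.sqrt (opnorm2 A / - q); pose w := h / - q.
have r_ge0 : 0 <= r by exact: sqrtr_ge0.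
have w_ge0 : 0 <= w by rewrite divr_ge0 ?frobenius_ge0// ltW.
have AE : opnorm2 A = r ^+ 2 * - q.
  by rewrite sqr_sqrtr ?divr_ge0 ?opnorm2_ge0 1?ltW// divfK// gt_eqF.
have hE : h = w * - q by rewrite divfK// gt_eqF.
have drw : delta * (r + w) < 1.
  by rewrite /delta mulrAC ltr_pdivrMr ?eta_a0_gt0// mul1r.
rewrite -(subrK Yc Y) addrC quadD -/A.
move: (Y - Yc) near => D near.
have := mxtrace_le_frobenius (grad P (Some (inr k)) Yc) D.
have := quadratic_form_le A D; rewrite ler_norml => /andP[_].
rewrite -/h -/q AE hE; have := frobenius_ge0 D; move: (frobenius D) near => d.
move: (\tr _) (\tr _) => x y near d_ge0 x_le y_le.
have dr : d * r <= delta * r by rewrite ler_wpM2r.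
have dw : d * w <= delta * w by rewrite ler_wpM2r.
have dr_ge0 := mulr_ge0 d_ge0 r_ge0; have dw_ge0 := mulr_ge0 d_ge0 w_ge0.
have drw1 : (d * r) ^+ 2 + d * w < 1 by nra.
have := mulr_gt0 q_gt0 (_ : 0 < 1 - ((d * r) ^+ 2 + d * w)).
by rewrite subr_gt0 => /(_ drw1); lra.
Qed.

Section Multipliers.
Variable kappa : R.

Let alpha := opnorm1 (qA P None).
Let rho1 := pencil_norm P (@opnorm1 R n).
Let rho2 := pencil_norm P (@opnorm2 R n).

Hypothesis kappa_gt0 : 0 < kappa.
Hypothesis kappa_le : forall tau, (forall k, k \notin binding P Yc -> tau k = 0) ->
  kappa * norm2 tau <= frobenius (\sum_k tau k *: grad P (Some k) Yc).
Hypothesis eta_kappa : alpha + a0 + 2 * (2 * rho1 + rho2) * g / kappa < eta.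
Hypothesis eta_nonbinding : forall k : I, inr k \notin binding P Yc ->
  a0 + g * (Num.sqrt (opnorm2 (qA P (Some (inr k)))
                      / `|quad P (Some (inr k)) Yc|)
            + frobenius (grad P (Some (inr k)) Yc)
              / `|quad P (Some (inr k)) Yc|) < eta.

Lemma alpha_ge0 : 0 <= alpha.
Proof. exact: opnorm1_ge0. Qed.

Lemma rho1_ge0 : 0 <= rho1.
Proof. exact: pencil_norm_ge0 (@opnorm1_ge0 R n) (@opnorm1_le_sum R n). Qed.

Lemma rho2_ge0 : 0 <= rho2.
Proof. exact: pencil_norm_ge0 (@opnorm2_ge0 R n) (@opnorm2_le_sum R n). Qed.

(** By stationarity the combination of constraint gradients at [Y] has the norm
    of the gradient of the penalized objective there. It differs from the same
    combination at [Yc], whose norm is at least [kappa * norm2 tau], by twice the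
    product of the pencil [sum_k tau_k A_k] with [Y - Yc]. *)
Lemma multiplier_le Y tau : frobenius (Y - Yc) <= delta ->
  (forall k, k \notin binding P Yc -> tau k = 0) -> lagrange_grad Y tau = 0 ->
  (kappa - 2 * rho2 * delta) * norm2 tau <= g + 2 * (a0 + eta) * delta.
Proof.
move=> near supp stat; set D := Y - Yc in near.
have eta_gt0 : 0 < eta by apply: le_lt_trans a0_eta; exact: opnorm2_ge0.
have YE : Y = Yc + D by rewrite addrC subrK.
have sum_grad : \sum_k tau k *: grad P (Some k) Yc
    = - (grad P None Yc + 2 *: (qA P None *m D) + (2 * eta) *: D)
      - 2 *: (pencil P tau *m D).
  have /eqP := stat; rewrite /lagrange_grad -/D addrC addr_eq0 => /eqP.
  rewrite YE gradD => <-; rewrite mulmx_suml scaler_sumr -sumrB.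
  apply: eq_bigr => k _; rewrite gradD scalerDr -scalemxAl !scalerA.
  by rewrite [2 * tau k]mulrC addrK.
have := kappa_le supp; rewrite {}sum_grad => le_kappa.
have := le_trans le_kappa (frobeniusD _ _); rewrite !frobeniusN.
have := frobeniusD (grad P None Yc + 2 *: (qA P None *m D)) ((2 * eta) *: D).
have := frobeniusD (grad P None Yc) (2 *: (qA P None *m D)).
rewrite -/g !frobeniusZ !ger0_norm ?mulr_ge0 ?(ltW eta_gt0)//.
have := frobenius_mulmx_le (qA P None) D; rewrite -/a0.
have := frobenius_pencil_le P tau D; rewrite -/rho2.
have a0_ge0 : 0 <= a0 by exact: opnorm2_ge0.
have := ler_wpM2l (mulr_ge0 rho2_ge0 (norm2_ge0 tau)) near.
have := ler_wpM2l (addr_ge0 a0_ge0 (ltW eta_gt0)) near.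
lra.
Qed.

Lemma margin_kappa : 2 * (2 * rho1 + rho2) * g < kappa * (eta - a0 - alpha).
Proof.
by move: eta_kappa; rewrite -ltrBrDl ltr_pdivrMr// mulrC; congr (_ < _); ring.
Qed.

Lemma margin_gt0 : 0 < eta - a0 - alpha.
Proof.
have := margin_kappa; have g_ge0 : 0 <= g by exact: frobenius_ge0.
have := mulr_ge0 rho1_ge0 g_ge0; have := mulr_ge0 rho2_ge0 g_ge0.
by move=> *; rewrite -(pmulr_rgt0 _ kappa_gt0); lra.
Qed.

Lemma delta_margin_le : delta * (eta - a0 - alpha) <= g.
Proof.
by have := mulr_ge0 delta_ge0 alpha_ge0; have := delta_mul; lra.
Qed.

Lemma kappa_delta_margin :
  4 * rho1 * g < (kappa - 2 * rho2 * delta) * (eta - a0 - alpha).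
Proof.
by have := margin_kappa; have := ler_wpM2l rho2_ge0 delta_margin_le; lra.
Qed.

Lemma kappa_delta_gt0 : 0 < kappa - 2 * rho2 * delta.
Proof.
rewrite -(pmulr_lgt0 _ margin_gt0); apply: le_lt_trans kappa_delta_margin.
by rewrite !mulr_ge0 ?rho1_ge0 ?frobenius_ge0.
Qed.

(** Put [y = eta - a0 - alpha]. Multiplying the bound on [T] by [y] and using
    [kappa_delta_margin], [delta y <= g] and [(eta - a0) delta = g], one gets
    [4 rho1 g T < g (3 y + 4 a0)], which is stronger than [rho1 T < y + a0] once
    [g] is cancelled; and [g = 0] forces [T = 0]. *)
Lemma multiplier_margin T : 0 <= T ->
  (kappa - 2 * rho2 * delta) * T <= g + 2 * (a0 + eta) * delta ->
  alpha + rho1 * T < eta.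
Proof.
move=> T_ge0 leT; have y_gt0 := margin_gt0.
have a0_ge0 : 0 <= a0 by exact: opnorm2_ge0.
have g_ge0 : 0 <= g by exact: frobenius_ge0.
have [T0|T_neq0] := eqVneq T 0; first by rewrite T0 mulr0 addr0; lra.
have T_gt0 : 0 < T by rewrite lt_def T_neq0.
have lt1 : 4 * rho1 * g * T < (g + 2 * (a0 + eta) * delta) * (eta - a0 - alpha).
  have lt2 : 4 * rho1 * g * T
      < (kappa - 2 * rho2 * delta) * (eta - a0 - alpha) * T.
    by rewrite ltr_pM2r// kappa_delta_margin.
  by apply: lt_le_trans lt2 _; rewrite mulrAC ler_wpM2r// ltW.
have lt3 : g * (4 * rho1 * T) < g * (3 * (eta - a0 - alpha) + 4 * a0).
  have := ler_wpM2l a0_ge0 delta_margin_le; have := delta_mul.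
  move=> xdl ady; apply: le_lt_trans (lt_le_trans lt1 _).
    by rewrite le_eqVlt; apply/orP; left; apply/eqP; ring.
  have -> : 2 * (a0 + eta) * delta = 2 * g + 4 * (a0 * delta) by rewrite -xdl; ring.
  lra.
have g_gt0 : 0 < g.
  by rewrite lt_def g_ge0 andbT; apply: contraTneq lt3 => ->; rewrite !mul0r ltxx.
by move: lt3; rewrite ltr_pM2l//; lra.
Qed.

(** An index type for the inequalities that pass to the limit along penalty
    minimizers. One side of complementary slackness suffices: the other one
    follows from feasibility and the signs of the multipliers. *)
Inductive kkt_condition :=
  Stationary of 'I_n & 'I_m | Violation of E + I | Sign of I | Slackness of E + I
  | Descent.

Definition kkt_defect Y tau (j : kkt_condition) : R :=
  match j with
  | Stationary i l => lagrange_grad Y tau i l ^+ 2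
  | Violation k => violation k (quad P (Some k) Y) ^+ 2
  | Sign k => - tau (inr k)
  | Slackness k => - (tau k * quad P (Some k) Y)
  | Descent => penalized Y - quad P None Yc
  end.

Lemma nonbinding_lt0 Y k : frobenius (Y - Yc) <= delta ->
  k \notin binding P Yc -> exists2 i : I, k = inr i & quad P (Some k) Y < 0.
Proof.
move=> near kB; case: k kB => [k|k] kB; first by move: kB; rewrite inE.
exists k => //; apply: nonbinding_stays near; last exact: eta_nonbinding.
move: kB; rewrite inE lt_neqAle => ->; exact: Yc_feasible.2.
Qed.

(** Only the violations are not exactly right at a penalty minimizer. Since the
    penalized objective is at least its value at [Yc] minus [g * delta], the
    violations satisfy [t * sum_k violation_k^2 <= g * delta]. *)
Lemma approximate_kkt e : 0 < e -> exists Y tau,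
  [/\ frobenius (Y - Yc) <= delta,
      (kappa - 2 * rho2 * delta) * norm2 tau <= g + 2 * (a0 + eta) * delta
    & forall j, kkt_defect Y tau j <= e].
Proof.
move=> e_gt0; have g_ge0 : 0 <= g by exact: frobenius_ge0.
have gdelta_ge0 := mulr_ge0 g_ge0 delta_ge0.
pose t := (g * delta + 1) / e.
have t_gt0 : 0 < t by rewrite divr_gt0// ltr_wpDl.
have [Y min_Y] := penalty_minimizer (ltW t_gt0).
have Y_le : penalty t Y <= quad P None Yc by rewrite -(penalty_Yc t).
have pen_le : penalized Y <= quad P None Yc.
  exact: le_trans (penalty_ge Y (ltW t_gt0)) Y_le.
have near := penalized_radius pen_le.
have stat := penalty_stationary (ltW t_gt0) min_Y.
set tau := (fun k => _) in stat.
exists Y, tau; split => //.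
  apply: (multiplier_le near _ stat) => k kB.
  have [i ki q_lt0] := nonbinding_lt0 near kB.
  move: q_lt0; rewrite /tau ki => q_lt0 /=.
  by have /max_idPr -> := ltW q_lt0; rewrite mulr0.
case=> [i l|k|k|k|] /=.
- by rewrite stat mxE expr0n ltW.
- have te : t * e = g * delta + 1 by rewrite divfK// gt_eqF.
  have one_le : violation k (quad P (Some k) Y) ^+ 2
      <= \sum_k violation k (quad P (Some k) Y) ^+ 2.
    by rewrite (bigD1 k)//= lerDl sumr_ge0// => i _; rewrite sqr_ge0.
  rewrite -(ler_pM2l t_gt0) te.
  have := ler_wpM2l (ltW t_gt0) one_le; have := penalized_lower Y.
  by move: Y_le; rewrite /penalty; lra.
- apply: le_trans (ltW e_gt0); rewrite oppr_le0 /tau.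
  apply: mulr_ge0; first by apply: mulr_ge0 => //; exact: ltW.
  by rewrite /= le_max lexx orbT.
- apply: le_trans (ltW e_gt0); rewrite oppr_le0 /tau /= -[_ * quad _ _ _]mulrA violation_mul.
  by apply: mulr_ge0; [apply: mulr_ge0 => //; exact: ltW|exact: sqr_ge0].
- by apply: le_trans (ltW e_gt0); rewrite subr_le0.
Qed.

(** Points near [Yc] and bounded multipliers fill a box, so approximate KKT
    pairs accumulate at an exact one. *)
Lemma exact_kkt : exists Y tau, forall j, kkt_defect Y tau j <= 0.
Proof.
pose T := (('I_n * 'I_m) + (E + I))%type.
pose Y_of (z : rfamily R T) : 'M[R]_(n, m) := Yc + \matrix_(i, l) z (inl (i, l)).
pose tau_of (z : rfamily R T) (k : E + I) : R := z (inr k).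
pose r := Num.max delta
  ((g + 2 * (a0 + eta) * delta) / (kappa - 2 * rho2 * delta)).
have c_Y : mx_continuous Y_of.
  apply: mx_continuousD; first exact: mx_continuous_cst.
  move=> i l.
  have -> : (fun z : rfamily R T =>
      (\matrix_(i, l) z (inl (i, l)) : 'M[R]_(n, m)) i l)
      = (fun z => z (inl (i, l))).
    by apply/funext => z; rewrite mxE.
  exact: continuous_coord.
have c_tau k : continuous (tau_of ^~ k) by exact: continuous_coord.
have c_grad k : mx_continuous (fun z => grad P k (Y_of z)).
  apply: (@mx_continuousZ _ _ _ _ (fun=> 2)); first exact: continuous_cstr.
  apply: mx_continuousD; last exact: mx_continuous_cst.
  by apply: mx_continuousM => //; exact: mx_continuous_cst.
have c_lagr : mx_continuous (fun z => lagrange_grad (Y_of z) (tau_of z)).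
  apply: mx_continuousD; last first.
    by apply: mx_continuous_sum => k; exact: mx_continuousZ.
  apply: mx_continuousD; first exact: c_grad.
  apply: (@mx_continuousZ _ _ _ _ (fun=> _)); first exact: continuous_cstr.
  by apply: mx_continuousD => //; exact: mx_continuous_cst.
have c_defect j : continuous (fun z => kkt_defect (Y_of z) (tau_of z) j).
  case: j => [i l|k|k|k|] /=.
  - exact: (continuous_mulr (c_lagr i l) (c_lagr i l)).
  - by apply: continuous_violation; exact: continuous_quad.
  - by apply: (@continuous_oppr _ _ (fun z => _)); exact: c_tau.
  - by apply: (@continuous_oppr _ _ (fun z => _)); apply: continuous_mulr; [exact: c_tau|exact: continuous_quad].
  - apply: (@continuous_addr _ _ (fun z => penalized _) (fun=> _)).
      exact: continuous_penalized.
    exact: continuous_cstr.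
have [|z _ kkt] := box_solution (r := r) c_defect; last by exists (Y_of z), (tau_of z).
move=> e /approximate_kkt [Y [tau [near tau_le kkt]]].
exists (fun p : T => match p with inl ij => (Y - Yc) ij.1 ij.2 | inr k => tau k end).
  move=> [[i l]|k]; rewrite /r le_max; apply/orP; [left|right].
    exact: le_trans (normr_le_frobenius _ _ _) near.
  rewrite ler_pdivlMr ?kappa_delta_gt0// mulrC.
  by apply: le_trans tau_le; rewrite ler_pM2l ?kappa_delta_gt0// normr_le_norm2.
move=> j; rewrite (_ : Y_of _ = Y); first exact: kkt.
by apply/matrixP => i l; rewrite !mxE addrCA subrr addr0.
Qed.

Lemma penalty_solution : exists Ys : 'M[R]_(n, m),
  unique (relax_optimal P Yc eta) (Ys, Ys *m Ys^T)
  /\ quad P None Ys <= quad P None Yc.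
Proof.
have [Y [tau kkt]] := exact_kkt; exists Y.
have stat : lagrange_grad Y tau = 0.
  apply/matrixP => i l; rewrite [RHS]mxE; apply/eqP; rewrite -sqrf_eq0 eq_le.
  by rewrite sqr_ge0 andbT; exact: (kkt (Stationary i l)).
have viol k : violation k (quad P (Some k) Y) = 0.
  by apply/eqP; rewrite -sqrf_eq0 eq_le sqr_ge0 andbT; exact: (kkt (Violation k)).
have feasY : feasible P Y.
  split=> k; first exact: (viol (inl k)).
  by rewrite -[leRHS](viol (inr k)) /= le_max lexx.
have tau_ge0 (k : I) : 0 <= tau (inr k).
  by rewrite -oppr_le0; exact: (kkt (Sign k)).
have slack k : tau k * quad P (Some k) Y = 0.
  apply/eqP; rewrite eq_le -oppr_le0 (kkt (Slackness k)) andbT.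
  case: k => k; first by rewrite feasY.1 mulr0.
  by rewrite mulr_ge0_le0// feasY.2.
have desc : penalized Y <= quad P None Yc by rewrite -subr_le0; exact: (kkt Descent).
have near := penalized_radius desc.
have supp k : k \notin binding P Yc -> tau k = 0.
  move=> kB; have [i _ q_lt0] := nonbinding_lt0 near kB.
  by have /eqP := slack k; rewrite mulf_eq0 (lt_eqF q_lt0) orbF => /eqP.
have tau_lt := multiplier_margin (norm2_ge0 tau) (multiplier_le near supp stat).
have eta_ge0 : 0 <= eta.
  by apply: ltW; apply: le_lt_trans a0_eta; exact: opnorm2_ge0.
split; last first.
  by apply: le_trans desc; rewrite lerDl mulr_ge0// sqr_ge0.
apply: (kkt_relax_unique feasY tau_ge0 slack stat _ tau_lt) => j.
apply: le_trans (lerD (col_sum_le_opnorm1 _ j) (col_sum_pencil_le P tau j)).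
rewrite -big_split/=; apply: ler_sum => i _; rewrite mxE.
exact: ler_normD.
Qed.

End Multipliers.

End Penalty.

(** * The Jacobian of the binding constraints *)

Section BindingJacobian.
Context {R : realType} {n m : nat} {E I : finType} (P : qcqp R n m E I).
Variable Yc : 'M[R]_(n, m).

Let B := binding P Yc.
Let J := constraint_jacobian P B Yc.

Lemma mul_constraint_jacobian (v : 'rV[R]_#|B|) :
  v *m J = mxvec (\sum_i v 0 i *: grad P (Some (enum_val i)) Yc).
Proof.
rewrite mulmx_sum_row linear_sum/=; apply: eq_bigr => i _.
by rewrite /J rowK [RHS]linearZ.
Qed.

Lemma frobenius_mul_constraint_jacobian (v : 'rV[R]_#|B|) :
  frobenius (v *m J)
  = frobenius (\sum_i v 0 i *: grad P (Some (enum_val i)) Yc).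
Proof. by rewrite mul_constraint_jacobian -norm2_row -frobenius_mxvec. Qed.

Hypothesis Yc_licq : licq P Yc.

Lemma licq_card_le : (#|B| <= n * m)%N.
Proof.
have := Yc_licq; rewrite /licq /free size_map -cardE => /eqP <-.
by apply: leq_trans (dimvS (subvf _)) _; rewrite dimvf /dim/=.
Qed.

Lemma licq_jacobian_inj (v : 'rV[R]_#|B|) : v *m J = 0 -> v = 0.
Proof.
rewrite mul_constraint_jacobian => /eqP; rewrite mxvec_eq0 => /eqP sum0.
have free_B : free (map_tuple (fun k => grad P (Some k) Yc) (enum_tuple B)).
  exact: Yc_licq.
apply/rowP => i; rewrite mxE; apply: (elimT freeP free_B (v 0)) i.
rewrite -[RHS]sum0; apply: eq_bigr => j _; congr (_ *: _).
by rewrite (nth_map (enum_default j)) -?cardE// enum_val_nth.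
Qed.

(** A lower bound [kappa] for the Jacobian of the binding constraints takes the
    place of the singularity function; when no constraint is binding any
    [kappa] will do, and a large one plays the role of infinity. *)
Lemma binding_lower_bound a c eta : 0 <= c ->
  (a%:E + c%:E / singularity P Yc < eta%:E)%E ->
  exists kappa, [/\ 0 < kappa, a + c / kappa < eta
    & forall tau : E + I -> R, (forall k, k \notin B -> tau k = 0) ->
      kappa * norm2 tau <= frobenius (\sum_k tau k *: grad P (Some k) Yc)].
Proof.
move=> c_ge0; rewrite /singularity -/B.
case: eqP => [B0|/eqP B_neq0].
  rewrite invey mule0 adde0 lte_fin => a_eta.
  have gap : 0 < eta - a by rewrite subr_gt0.
  exists ((c + 1) / (eta - a)); split.
  - by rewrite divr_gt0// ltr_wpDl.
  - rewrite invf_div mulrCA -ltrBrDl gtr_pMr//.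
    by rewrite ltr_pdivrMr ?ltr_wpDl// mul1r ltrDl.
  - move=> tau supp; have tau0 : tau = fun=> 0.
      by apply/funext => k; apply: supp; rewrite B0 inE.
    by rewrite tau0 norm2_cst0 mulr0 frobenius_ge0.
rewrite licq_card_le.
have B_gt0 : (0 < #|B|)%N by rewrite card_gt0.
have s_gt0 := sigma_min_gt0 B_gt0 licq_card_le licq_jacobian_inj.
rewrite inver gt_eqF// -EFinM -EFinD lte_fin => a_eta.
exists (sigma_min J); split=> // tau supp.
pose v : 'rV[R]_#|B| := \row_i tau (enum_val i).
have -> : norm2 tau = frobenius v.
  rewrite -norm2_row /norm2; congr Num.sqrt.
  rewrite (bigID (mem B))/= [X in _ + X]big1 ?addr0 => [|k /supp ->]; last first.
    by rewrite expr0n.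
  by rewrite big_enum_val; apply: eq_bigr => i _; rewrite mxE.
have -> : \sum_k tau k *: grad P (Some k) Yc
    = \sum_i v 0 i *: grad P (Some (enum_val i)) Yc.
  rewrite (bigID (mem B))/= [X in _ + X]big1 ?addr0 => [|k /supp ->]; last first.
    by rewrite scale0r.
  by rewrite big_enum_val; apply: eq_bigr => i _; rewrite mxE.
rewrite -frobenius_mul_constraint_jacobian.
exact: sigma_min_le B_gt0 licq_card_le v.
Qed.

End BindingJacobian.

Theorem theorem1 (R : realType) (n m : nat) (E I : finType)
    (P : qcqp R n m E I) (Yc : 'M[R]_(n, m)) (eta : R)
    (eta_gt0 : 0 < eta)
    (Yc_feasible : feasible P Yc)
    (Yc_licq : licq P Yc)
    (eta_binding :
      ((opnorm1 (qA P None) + opnorm2 (qA P None))%:E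
       + (2 * (2 * pencil_norm P (@opnorm1 R n) + pencil_norm P (@opnorm2 R n))
            * frobenius (grad P None Yc))%:E / singularity P Yc
       < eta%:E)%E)
    (eta_nonbinding : forall k : I, inr k \notin binding P Yc ->
      opnorm2 (qA P None)
      + frobenius (grad P None Yc)
        * (Num.sqrt (opnorm2 (qA P (Some (inr k)))
                     / `|quad P (Some (inr k)) Yc|)
           + frobenius (grad P (Some (inr k)) Yc)
             / `|quad P (Some (inr k)) Yc|)
      < eta) :
  exists (Ys : 'M[R]_(n, m)) (Xs : 'M[R]_n),
    [/\ unique (relax_optimal P Yc eta) (Ys, Xs),
        Xs = Ys *m Ys^T
      & quad P None Ys <= quad P None Yc].
Proof.
have rho1_ge0 : 0 <= pencil_norm P (@opnorm1 R n).
  exact: pencil_norm_ge0 (@opnorm1_ge0 R n) (@opnorm1_le_sum R n).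
have rho2_ge0 : 0 <= pencil_norm P (@opnorm2 R n).
  exact: pencil_norm_ge0 (@opnorm2_ge0 R n) (@opnorm2_le_sum R n).
have c_ge0 : 0 <= 2 * (2 * pencil_norm P (@opnorm1 R n)
    + pencil_norm P (@opnorm2 R n)) * frobenius (grad P None Yc).
  by rewrite mulr_ge0 ?frobenius_ge0// mulr_ge0// addr_ge0// mulr_ge0.
have [kappa [kappa_gt0 eta_kappa kappa_le]] :=
  binding_lower_bound Yc_licq c_ge0 eta_binding.
have a0_eta : opnorm2 (qA P None) < eta.
  apply: le_lt_trans eta_kappa; rewrite addrAC lerDr.
  by rewrite addr_ge0 ?opnorm1_ge0// divr_ge0// ltW.
have [Ys [Ys_unique Ys_le]] := penalty_solution Yc_feasible a0_eta kappa_gt0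
  kappa_le eta_kappa eta_nonbinding.
by exists Ys, (Ys *m Ys^T).
Qed.
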